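(* Let $p$ be a prime and $F\in\{\mathbb{C},\mathbb{R},\mathbb{F}_q\}$ with $\operatorname{char}(\mathbb{F}_q)\neq p$. For all $n\ge0$, there is an isomorphism of $\mathcal{E}(n)_p^\vee$-comodules $$H_{*,*}BPGL\langle n\rangle\cong\bigoplus_{k\ge0}\Sigma^{2k(p-1),\,k(p-1)}B_{n-1}(k).$$
   Context: $H=H\mathbb{F}_p$ is the motivic Eilenberg--MacLane spectrum over $F$, $\mathbb{M}_p=\pi_{*,*}H$, and $\mathcal{A}_p^\vee=\pi_{*,*}(H\wedge H)$ is the motivic dual Steenrod algebra (Voevodsky), a Hopf algebroid over $\mathbb{M}_p$ generated as an algebra by $\tau_i$ ($i\ge0$) and $\xi_i$ ($i\ge1$), with conjugates $\bar\tau_i,\bar\xi_i$ in degrees $|\bar\tau_i|=(2p^i-1,p^i-1)$, $|\bar\xi_i|=(2p^i-2,p^i-1)$, and coproduct $\psi(\bar\tau_k)=1\otimes\bar\tau_k+\sum_{i+j=k}\bar\tau_i\otimes\bar\xi_j^{p^i}$, $\psi(\bar\xi_k)=\sum_{i+j=k}\bar\xi_i\otimes\bar\xi_j^{p^i}$ ($\bar\xi_0=1$). $\mathcal{E}(n)_p^\vee$ is the quotient Hopf algebroid $\mathcal{A}_p^\vee/(\bar\xi_i\ (i\ge1),\ \bar\tau_j\ (j>n))$, with $\mathbb{M}_p$-algebra generators $\bar\tau_0,\dots,\bar\tau_n$; it is dual to the subalgebra $\mathcal{E}(n)_p$ of the Steenrod algebra generated by the Milnor primitives $Q_0,\dots,Q_n$.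 By convention $\mathcal{E}(-1)_p^\vee=\mathbb{M}_p$. $BPGL\langle n\rangle=BPGL/(v_{n+1},v_{n+2},\dots)$ is the truncated motivic Brown--Peterson spectrum at $p$. The map $H_{*,*}BPGL\langle n\rangle\to H_{*,*}H=\mathcal{A}_p^\vee$ is injective with image the subalgebra $(\mathcal{A}//\mathcal{E}(n))^\vee=\mathcal{A}_p^\vee\,\Box_{\mathcal{E}(n)_p^\vee}\mathbb{M}_p$ generated over $\mathbb{M}_p$ by $\bar\xi_1,\bar\xi_2,\dots,\bar\tau_{n+1},\bar\tau_{n+2},\dots$. Its left $\mathcal{E}(n)_p^\vee$-coaction is induced by $\psi$ followed by projection on the left factor; the same holds for $n=-1$ with $(\mathcal{A}//\mathcal{E}(-1))^\vee=\mathcal{A}_p^\vee$. Weight filtration: $\operatorname{wt}(\bar\xi_i)=\operatorname{wt}(\bar\tau_i)=p^i$, extended by $\operatorname{wt}(xy)=\operatorname{wt}(x)+\operatorname{wt}(y)$. The $k$-th Brown--Gitler comodule $B_n(k)$ is the $\mathbb{M}_p$-span in $(\mathcal{A}//\mathcal{E}(n))^\vee$ of monomials of weight at most $k$. $B_{n-1}(k)$ is regarded as an $\mathcal{E}(n)_p^\vee$-comodule via the left coaction obtained from $\psi$. $\Sigma^{a,b}$ denotes a bigraded shift. *)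

(* Defs.v *)
From HB Require Import structures.
From mathcomp Require Import all_boot all_order all_algebra.
From mathcomp Require Import boolp.

Set Implicit Arguments.
Unset Strict Implicit.
Unset Printing Implicit Defensive.

Import GRing.Theory.
Local Open Scope ring_scope.
Local Open Scope quotient_scope.

Declare Scope rexpr_scope.
Delimit Scope rexpr_scope with rx.

(* Rings presented by generators and relations: ring expressions in the
   generators modulo the congruence generated by the (unital, associative,
   not necessarily commutative) ring axioms and the relations. *)
Inductive rexpr (G : Type) : Type :=
| RGen of G
| RZero
| ROne
| ROpp of rexpr G
| RAdd of rexpr G & rexpr G
| RMul of rexpr G & rexpr G.
Arguments RZero {G}.
Arguments ROne {G}.
Bind Scope rexpr_scope with rexpr.
Notation "0" := RZero : rexpr_scope.
Notation "1" := ROne : rexpr_scope.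
Notation "- s" := (ROpp s) : rexpr_scope.
Notation "s + t" := (RAdd s t) : rexpr_scope.
Notation "s * t" := (RMul s t) : rexpr_scope.

Fixpoint rmap (G G' : Type) (f : G -> G') (s : rexpr G) : rexpr G' :=
  match s with
  | RGen g => RGen (f g)
  | RZero => RZero
  | ROne => ROne
  | ROpp t => ROpp (rmap f t)
  | RAdd t u => RAdd (rmap f t) (rmap f u)
  | RMul t u => RMul (rmap f t) (rmap f u)
  end.

Fixpoint reval (R : pzRingType) (G : Type) (v : G -> R) (s : rexpr G) : R :=
  match s with
  | RGen g => v g
  | RZero => 0
  | ROne => 1
  | ROpp t => - reval v t
  | RAdd t u => reval v t + reval v u
  | RMul t u => reval v t * reval v u
  end.

HB.instance Definition _ (G : Type) := gen_eqMixin (rexpr G).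
HB.instance Definition _ (G : Type) := gen_choiceMixin (rexpr G).

Section Presented.
Variables (G : Type) (rel : rexpr G -> rexpr G -> Prop).

Inductive rcong : rexpr G -> rexpr G -> Prop :=
| rcong_rel s t : rel s t -> rcong s t
| rcong_refl s : rcong s s
| rcong_sym s t : rcong s t -> rcong t s
| rcong_trans s t u : rcong s t -> rcong t u -> rcong s u
| rcong_opp s s' : rcong s s' -> rcong (- s)%rx (- s')%rx
| rcong_add s s' t t' :
    rcong s s' -> rcong t t' -> rcong (s + t)%rx (s' + t')%rx
| rcong_mul s s' t t' :
    rcong s s' -> rcong t t' -> rcong (s * t)%rx (s' * t')%rx
| rcong_addA s t u : rcong (s + (t + u))%rx (s + t + u)%rx
| rcong_addC s t : rcong (s + t)%rx (t + s)%rx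
| rcong_add0 s : rcong (0 + s)%rx s
| rcong_addN s : rcong (- s + s)%rx 0%rx
| rcong_mulA s t u : rcong (s * (t * u))%rx (s * t * u)%rx
| rcong_mul1l s : rcong (1 * s)%rx s
| rcong_mul1r s : rcong (s * 1)%rx s
| rcong_mulDl s t u : rcong ((s + t) * u)%rx (s * u + t * u)%rx
| rcong_mulDr s t u : rcong (s * (t + u))%rx (s * t + s * u)%rx.

Definition rcongb (s t : rexpr G) : bool := `[< rcong s t >].

Lemma rcongb_refl : reflexive rcongb.
Proof. by move=> s; apply/asboolP; apply: rcong_refl. Qed.

Lemma rcongb_sym : symmetric rcongb.
Proof. by move=> s t; apply/asboolP/asboolP; apply: rcong_sym. Qed.

Lemma rcongb_trans : transitive rcongb.
Proof.
by move=> t s u /asboolP st /asboolP tu; apply/asboolP; apply: rcong_trans tu.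
Qed.

Canonical rcong_equiv :=
  EquivRel rcongb rcongb_refl rcongb_sym rcongb_trans.

Definition presented : Type := {eq_quot rcong_equiv}.
HB.instance Definition _ := Choice.on presented.
HB.instance Definition _ : EqQuotient _ rcong_equiv presented :=
  EqQuotient.on presented.

Definition cls (s : rexpr G) : presented := \pi_presented s.

Lemma clsP s t : cls s = cls t <-> rcong s t.
Proof.
split=> [/eqP|st]; first by rewrite /cls piE => /asboolP.
by apply/eqP; rewrite /cls piE; apply/asboolP.
Qed.

Lemma repr_cls s : rcong (repr (cls s)) s.
Proof. by apply/clsP; rewrite /cls reprK. Qed.

Lemma cls_repr (x : presented) : cls (repr x) = x.
Proof. exact: reprK. Qed.

Lemma cls_ind (P : presented -> Prop) : (forall s, P (cls s)) -> forall x, P x.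
Proof. by move=> H x; rewrite -(cls_repr x). Qed.

Definition padd (x y : presented) := cls (repr x + repr y)%rx.
Definition popp (x : presented) := cls (- repr x)%rx.
Definition pmul (x y : presented) := cls (repr x * repr y)%rx.

Lemma cls_add s t : padd (cls s) (cls t) = cls (s + t)%rx.
Proof. by apply/clsP; apply: rcong_add; apply: repr_cls. Qed.

Lemma cls_opp s : popp (cls s) = cls (- s)%rx.
Proof. by apply/clsP; apply: rcong_opp; apply: repr_cls. Qed.

Lemma cls_mul s t : pmul (cls s) (cls t) = cls (s * t)%rx.
Proof. by apply/clsP; apply: rcong_mul; apply: repr_cls. Qed.

Lemma paddA : associative padd.
Proof.
elim/cls_ind=> s; elim/cls_ind=> t; elim/cls_ind=> u; rewrite !cls_add.
by apply/clsP; apply: rcong_addA.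
Qed.

Lemma paddC : commutative padd.
Proof.
elim/cls_ind=> s; elim/cls_ind=> t; rewrite !cls_add.
by apply/clsP; apply: rcong_addC.
Qed.

Lemma padd0 : left_id (cls 0%rx) padd.
Proof. by elim/cls_ind=> s; rewrite cls_add; apply/clsP; apply: rcong_add0. Qed.

Lemma paddN : left_inverse (cls 0%rx) popp padd.
Proof.
by elim/cls_ind=> s; rewrite cls_opp cls_add; apply/clsP; apply: rcong_addN.
Qed.

HB.instance Definition _ := GRing.isZmodule.Build presented paddA paddC padd0 paddN.

Lemma pmulA : associative pmul.
Proof.
elim/cls_ind=> s; elim/cls_ind=> t; elim/cls_ind=> u; rewrite !cls_mul.
by apply/clsP; apply: rcong_mulA.
Qed.

Lemma pmul1l : left_id (cls 1%rx) pmul.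
Proof. by elim/cls_ind=> s; rewrite cls_mul; apply/clsP; apply: rcong_mul1l. Qed.

Lemma pmul1r : right_id (cls 1%rx) pmul.
Proof. by elim/cls_ind=> s; rewrite cls_mul; apply/clsP; apply: rcong_mul1r. Qed.

Lemma pmulDl : left_distributive pmul +%R.
Proof.
elim/cls_ind=> s; elim/cls_ind=> t; elim/cls_ind=> u.
rewrite /GRing.add /= cls_add !cls_mul cls_add.
by apply/clsP; apply: rcong_mulDl.
Qed.

Lemma pmulDr : right_distributive pmul +%R.
Proof.
elim/cls_ind=> s; elim/cls_ind=> t; elim/cls_ind=> u.
rewrite /GRing.add /= cls_add !cls_mul cls_add.
by apply/clsP; apply: rcong_mulDr.
Qed.

HB.instance Definition _ :=
  GRing.Zmodule_isPzRing.Build presented pmulA pmul1l pmul1r pmulDl pmulDr.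

Definition gen (g : G) : presented := cls (RGen g).

Lemma clsD s t : cls (s + t)%rx = cls s + cls t.
Proof. by rewrite -cls_add. Qed.

Lemma clsN s : cls (- s)%rx = - cls s.
Proof. by rewrite -cls_opp. Qed.

Lemma clsM s t : cls (s * t)%rx = cls s * cls t.
Proof. by rewrite -cls_mul. Qed.

Lemma cls0 : cls 0%rx = 0. Proof. by []. Qed.
Lemma cls1 : cls 1%rx = 1. Proof. by []. Qed.

Lemma reval_gen s : reval gen s = cls s.
Proof.
by elim: s => //= [s ->|s -> t ->|s -> t ->]; rewrite ?clsN ?clsD ?clsM.
Qed.

Lemma presented_rel s t : rel s t -> reval gen s = reval gen t.
Proof. by move=> st; rewrite !reval_gen; apply/clsP/rcong_rel. Qed.

Lemma presented_ind (P : presented -> Prop) :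
  (forall g, P (gen g)) -> P 0 -> P 1 -> (forall x, P x -> P (- x)) ->
  (forall x y, P x -> P y -> P (x + y)) ->
  (forall x y, P x -> P y -> P (x * y)) -> forall x, P x.
Proof.
move=> Pg P0 P1 PN PD PM; elim/cls_ind; elim=> //=.
- by move=> s IHs; rewrite clsN; apply: PN.
- by move=> s IHs t IHt; rewrite clsD; apply: PD.
- by move=> s IHs t IHt; rewrite clsM; apply: PM.
Qed.

Section Lift.
Variables (R : pzRingType) (v : G -> R).
Definition rlift (x : presented) : R := reval v (repr x).

Hypothesis sat : forall s t, rel s t -> reval v s = reval v t.

Lemma reval_cong s t : rcong s t -> reval v s = reval v t.
Proof.
elim=> {s t} //=.
- by move=> s t u _ -> _ ->.
- by move=> s s' _ ->.
- by move=> s s' t t' _ -> _ ->.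
- by move=> s s' t t' _ -> _ ->.
- by move=> s t u; rewrite addrA.
- by move=> s t; rewrite addrC.
- by move=> s; rewrite add0r.
- by move=> s; rewrite addNr.
- by move=> s t u; rewrite mulrA.
- by move=> s; rewrite mul1r.
- by move=> s; rewrite mulr1.
- by move=> s t u; rewrite mulrDl.
- by move=> s t u; rewrite mulrDr.
Qed.

Lemma rlift_cls s : rlift (cls s) = reval v s.
Proof. by apply: reval_cong; apply: repr_cls. Qed.

Lemma rlift_gen g : rlift (gen g) = v g.
Proof. exact: rlift_cls. Qed.

Lemma rlift_zmod : zmod_morphism rlift.
Proof.
elim/cls_ind=> s; elim/cls_ind=> t.
by rewrite -clsN -clsD !rlift_cls.
Qed.

Lemma rlift_monoid : monoid_morphism rlift.
Proof.
split; first by rewrite -cls1 rlift_cls.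
by elim/cls_ind=> s; elim/cls_ind=> t; rewrite -clsM !rlift_cls.
Qed.
End Lift.

(* Given additive operators op g on an abelian group, a ring expression acts
   by sums and composites. *)
Section Act.
Variables (V : zmodType) (op : G -> V -> V).
Fixpoint ract (s : rexpr G) (x : V) : V :=
  match s with
  | RGen g => op g x
  | RZero => 0
  | ROne => x
  | ROpp t => - ract t x
  | RAdd t u => ract t x + ract u x
  | RMul t u => ract t (ract u x)
  end.

Hypothesis opB : forall g, zmod_morphism (op g).

Lemma ractB s : zmod_morphism (ract s).
Proof.
elim: s => //= [x y|s IHs x y|s IHs t IHt x y|s IHs t IHt x y].
- by rewrite subr0.
- by rewrite IHs opprB [RHS]addrC opprK.
- by rewrite IHs IHt addrACA opprD.
- by rewrite IHt IHs.
Qed.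

Hypothesis sat : forall s t, rel s t -> ract s =1 ract t.

Lemma ract_cong s t : rcong s t -> ract s =1 ract t.
Proof.
elim=> {s t} //=.
- by move=> s t _ IH x; rewrite IH.
- by move=> s t u _ IH1 _ IH2 x; rewrite IH1 IH2.
- by move=> s s' _ IH x; rewrite IH.
- by move=> s s' t t' _ IH1 _ IH2 x; rewrite IH1 IH2.
- by move=> s s' t t' _ IH1 _ IH2 x; rewrite IH2 IH1.
- by move=> s t u x; rewrite addrA.
- by move=> s t x; rewrite addrC.
- by move=> s x; rewrite add0r.
- by move=> s x; rewrite addNr.
- move=> s t u x.
  have -> : ract t x + ract u x = ract t x - (- ract u x) by rewrite opprK.
  have sN y : ract s (- y) = - ract s y.
    by rewrite -[- y]add0r ractB -{1}(subrr y) ractB subrr add0r.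
  by rewrite ractB sN opprK.
Qed.
End Act.

End Presented.

(* The tensor product E \otimes_M N of a right M-module E (here a ring, acted
   on through a ring morphism etaR) and a left M-module N, as an abelian
   group: formal sums of e \otimes n modulo biadditivity and balancedness. *)
Inductive texpr (E N : Type) : Type :=
| TTens of E & N
| TZero
| TOpp of texpr E N
| TAdd of texpr E N & texpr E N.
Arguments TZero {E N}.

HB.instance Definition _ (E N : Type) := gen_eqMixin (texpr E N).
HB.instance Definition _ (E N : Type) := gen_choiceMixin (texpr E N).

Section Tensor.
Variables (M E : pzRingType) (etaR : {rmorphism M -> E}) (N : lmodType M).

Inductive tcong : texpr E N -> texpr E N -> Prop :=
| tcong_refl s : tcong s s
| tcong_sym s t : tcong s t -> tcong t s
| tcong_trans s t u : tcong s t -> tcong t u -> tcong s u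
| tcong_opp s s' : tcong s s' -> tcong (TOpp s) (TOpp s')
| tcong_add s s' t t' :
    tcong s s' -> tcong t t' -> tcong (TAdd s t) (TAdd s' t')
| tcong_addA s t u : tcong (TAdd s (TAdd t u)) (TAdd (TAdd s t) u)
| tcong_addC s t : tcong (TAdd s t) (TAdd t s)
| tcong_add0 s : tcong (TAdd TZero s) s
| tcong_addN s : tcong (TAdd (TOpp s) s) TZero
| tcong_tensDl e e' n :
    tcong (TTens (e + e') n) (TAdd (TTens e n) (TTens e' n))
| tcong_tensDr e n n' :
    tcong (TTens e (n + n')) (TAdd (TTens e n) (TTens e n'))
| tcong_bal e m n : tcong (TTens (e * etaR m) n) (TTens e (m *: n)).

Definition tcongb (s t : texpr E N) : bool := `[< tcong s t >].

Lemma tcongb_refl : reflexive tcongb.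
Proof. by move=> s; apply/asboolP; apply: tcong_refl. Qed.

Lemma tcongb_sym : symmetric tcongb.
Proof. by move=> s t; apply/asboolP/asboolP; apply: tcong_sym. Qed.

Lemma tcongb_trans : transitive tcongb.
Proof.
by move=> t s u /asboolP st /asboolP tu; apply/asboolP; apply: tcong_trans tu.
Qed.

Canonical tcong_equiv :=
  EquivRel tcongb tcongb_refl tcongb_sym tcongb_trans.

Definition tensor : Type := {eq_quot tcong_equiv}.
HB.instance Definition _ := Choice.on tensor.
HB.instance Definition _ : EqQuotient _ tcong_equiv tensor :=
  EqQuotient.on tensor.

Definition tcls (s : texpr E N) : tensor := \pi_tensor s.

Lemma tclsP s t : tcls s = tcls t <-> tcong s t.
Proof.
split=> [/eqP|st]; first by rewrite /tcls piE => /asboolP.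
by apply/eqP; rewrite /tcls piE; apply/asboolP.
Qed.

Lemma repr_tcls s : tcong (repr (tcls s)) s.
Proof. by apply/tclsP; rewrite /tcls reprK. Qed.

Lemma tcls_repr (x : tensor) : tcls (repr x) = x.
Proof. exact: reprK. Qed.

Lemma tcls_ind (P : tensor -> Prop) : (forall s, P (tcls s)) -> forall x, P x.
Proof. by move=> H x; rewrite -(tcls_repr x). Qed.

Definition tadd (x y : tensor) := tcls (TAdd (repr x) (repr y)).
Definition topp (x : tensor) := tcls (TOpp (repr x)).

Lemma tcls_add s t : tadd (tcls s) (tcls t) = tcls (TAdd s t).
Proof. by apply/tclsP; apply: tcong_add; apply: repr_tcls. Qed.

Lemma tcls_opp s : topp (tcls s) = tcls (TOpp s).
Proof. by apply/tclsP; apply: tcong_opp; apply: repr_tcls. Qed.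

Lemma taddA : associative tadd.
Proof.
elim/tcls_ind=> s; elim/tcls_ind=> t; elim/tcls_ind=> u; rewrite !tcls_add.
by apply/tclsP; apply: tcong_addA.
Qed.

Lemma taddC : commutative tadd.
Proof.
elim/tcls_ind=> s; elim/tcls_ind=> t; rewrite !tcls_add.
by apply/tclsP; apply: tcong_addC.
Qed.

Lemma tadd0 : left_id (tcls TZero) tadd.
Proof.
by elim/tcls_ind=> s; rewrite tcls_add; apply/tclsP; apply: tcong_add0.
Qed.

Lemma taddN : left_inverse (tcls TZero) topp tadd.
Proof.
by elim/tcls_ind=> s; rewrite tcls_opp tcls_add; apply/tclsP/tcong_addN.
Qed.

HB.instance Definition _ :=
  GRing.isZmodule.Build tensor taddA taddC tadd0 taddN.

Definition tens (e : E) (n : N) : tensor := tcls (TTens e n).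

Lemma tclsD s t : tcls (TAdd s t) = tcls s + tcls t.
Proof. by rewrite -tcls_add. Qed.

Lemma tclsN s : tcls (TOpp s) = - tcls s.
Proof. by rewrite -tcls_opp. Qed.

Lemma tensDl e e' n : tens (e + e') n = tens e n + tens e' n.
Proof. by rewrite -tclsD; apply/tclsP/tcong_tensDl. Qed.

Lemma tensDr e n n' : tens e (n + n') = tens e n + tens e n'.
Proof. by rewrite -tclsD; apply/tclsP/tcong_tensDr. Qed.

Lemma tens_bal e m n : tens (e * etaR m) n = tens e (m *: n).
Proof. exact/tclsP/tcong_bal. Qed.

Lemma tens0l n : tens 0 n = 0.
Proof. by apply: (addrI (tens 0 n)); rewrite -tensDl !addr0. Qed.

Lemma tens0r e : tens e 0 = 0.
Proof. by apply: (addrI (tens e 0)); rewrite -tensDr !addr0. Qed.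

Lemma tensNl e n : tens (- e) n = - tens e n.
Proof. by apply: (addrI (tens e n)); rewrite -tensDl !subrr tens0l. Qed.

Lemma tensNr e n : tens e (- n) = - tens e n.
Proof. by apply: (addrI (tens e n)); rewrite -tensDr !subrr tens0r. Qed.

Lemma tensor_ind (P : tensor -> Prop) :
  (forall e n, P (tens e n)) -> P 0 -> (forall x, P x -> P (- x)) ->
  (forall x y, P x -> P y -> P (x + y)) -> forall x, P x.
Proof.
move=> Pt P0 PN PD; elim/tcls_ind; elim=> //=.
- by move=> s IHs; rewrite tclsN; apply: PN.
- by move=> s IHs t IHt; rewrite tclsD; apply: PD.
Qed.

(* tlift f is the additive map e \otimes n |-> f e n induced by a balanced
   biadditive f. *)
Section Lift.
Variables (G : zmodType) (f : E -> N -> G).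
Fixpoint teval (s : texpr E N) : G :=
  match s with
  | TTens e n => f e n
  | TZero => 0
  | TOpp t => - teval t
  | TAdd t u => teval t + teval u
  end.

Definition tlift (x : tensor) : G := teval (repr x).

Record balanced : Prop := Balanced {
  balDl : forall e e' n, f (e + e') n = f e n + f e' n;
  balDr : forall e n n', f e (n + n') = f e n + f e n';
  balM : forall e m n, f (e * etaR m) n = f e (m *: n) }.

Hypothesis balf : balanced.

Lemma teval_cong s t : tcong s t -> teval s = teval t.
Proof.
case: balf => fDl fDr fM; elim=> {s t} //=.
- by move=> s t u _ -> _ ->.
- by move=> s s' _ ->.
- by move=> s s' t t' _ -> _ ->.
- by move=> s t u; rewrite addrA.
- by move=> s t; rewrite addrC.
- by move=> s; rewrite add0r.
- by move=> s; rewrite addNr.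
Qed.

Lemma tlift_tcls s : tlift (tcls s) = teval s.
Proof. by apply: teval_cong; apply: repr_tcls. Qed.

Lemma tlift_tens e n : tlift (tens e n) = f e n.
Proof. exact: tlift_tcls. Qed.

Lemma tlift_zmod : zmod_morphism tlift.
Proof.
by elim/tcls_ind=> s; elim/tcls_ind=> t; rewrite -tclsN -tclsD !tlift_tcls.
Qed.
End Lift.

End Tensor.

(* tmap f g is the additive map e \otimes n |-> f e \otimes g n. *)
Section TensorMap.
Variables (M E E' : pzRingType).
Variables (etaR : {rmorphism M -> E}) (etaR' : {rmorphism M -> E'}).
Variables (N N' : lmodType M) (f : E -> E') (g : N -> N').

Definition tmap : tensor etaR N -> tensor etaR' N' :=
  tlift (fun e n => tens etaR' (f e) (g n)).

Record bimap : Prop := Bimap {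
  bimapDl : forall e e', f (e + e') = f e + f e';
  bimapDr : forall n n', g (n + n') = g n + g n';
  bimapM : forall e m n,
    tens etaR' (f (e * etaR m)) (g n) = tens etaR' (f e) (g (m *: n)) }.

Hypothesis fg : bimap.

Lemma bimap_balanced : balanced etaR (fun e n => tens etaR' (f e) (g n)).
Proof.
case: fg => fD gD fgM; split=> // [e e' n|e n n'].
- by rewrite fD tensDl.
- by rewrite gD tensDr.
Qed.

Lemma tmap_tens e n : tmap (tens etaR e n) = tens etaR' (f e) (g n).
Proof. exact: (tlift_tens bimap_balanced). Qed.

Lemma tmap_zmod : zmod_morphism tmap.
Proof. exact: (tlift_zmod bimap_balanced). Qed.

Lemma tmapB x y : tmap (x - y) = tmap x - tmap y.
Proof. exact: tmap_zmod. Qed.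

Lemma tmap0 : tmap 0 = 0.
Proof. by rewrite -(subrr 0) tmapB subrr. Qed.

Lemma tmapN x : tmap (- x) = - tmap x.
Proof. by rewrite -[- x]add0r tmapB tmap0 add0r. Qed.

Lemma tmapD x y : tmap (x + y) = tmap x + tmap y.
Proof. by rewrite -{1}[y]opprK tmapB tmapN opprK. Qed.
End TensorMap.

Arguments tmap {M E E'} etaR etaR' {N N'} f g x.

Record submodule (M : pzRingType) (V : lmodType M) := Submodule {
  sub_pred :> V -> Prop;
  sub_pred0 : sub_pred 0;
  sub_predL : forall a u v, sub_pred u -> sub_pred v -> sub_pred (a *: u + v) }.

Section SubmoduleCarrier.
Variables (M : pzRingType) (V : lmodType M) (S : submodule V).

Definition sub_mem : {pred V} := fun x => `[< S x >].

Lemma sub_mem_closed : submod_closed sub_mem.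
Proof.
split=> [|a u v]; first by apply/asboolP; apply: sub_pred0.
by move=> /asboolP Su /asboolP Sv; apply/asboolP; apply: sub_predL.
Qed.

HB.instance Definition _ := GRing.isSubmodClosed.Build M V sub_mem sub_mem_closed.

Record sub_car : Type := SubCar { sub_val : V; sub_valP : sub_val \in sub_mem }.
HB.instance Definition _ := [isSub for sub_val].
HB.instance Definition _ := [Choice of sub_car by <:].
HB.instance Definition _ := [SubChoice_isSubLmodule of sub_car by <:].

Definition sub_in (x : V) (Sx : S x) : sub_car := SubCar (asboolT Sx).

Lemma sub_car_pred (x : sub_car) : S (sub_val x).
Proof. exact/asboolP/(sub_valP x). Qed.
End SubmoduleCarrier.

Section DirectSum.
Variables (M : pzRingType) (V : nat -> lmodType M).

Definition fin_supp (f : forall k, V k) : Prop :=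
  exists m, forall k, (m <= k)%N -> f k = 0.

Record dsum : Type := Dsum {
  dsum_fun :> forall k, V k;
  dsum_fin : fin_supp dsum_fun }.

HB.instance Definition _ := gen_eqMixin dsum.
HB.instance Definition _ := gen_choiceMixin dsum.

Lemma dsumP (f g : dsum) : (forall k, f k = g k) -> f = g.
Proof.
case: f g => [f Hf] [g Hg] /= fg.
have {}fg : f = g by apply: functional_extensionality_dep.
by rewrite fg in Hf *; congr Dsum; apply: Prop_irrelevance.
Qed.

Lemma fin_supp0 : fin_supp (fun k => 0). Proof. by exists 0%N. Qed.

Lemma fin_suppD (f g : dsum) : fin_supp (fun k => f k + g k).
Proof.
have [m fm] := dsum_fin f; have [m' gm] := dsum_fin g.
exists (maxn m m') => k; rewrite geq_max => /andP[mk m'k].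
by rewrite fm // gm // addr0.
Qed.

Lemma fin_suppN (f : dsum) : fin_supp (fun k => - f k).
Proof. by have [m fm] := dsum_fin f; exists m => k mk; rewrite fm // oppr0. Qed.

Lemma fin_suppZ (a : M) (f : dsum) : fin_supp (fun k => a *: f k).
Proof. by have [m fm] := dsum_fin f; exists m => k mk; rewrite fm // scaler0. Qed.

Lemma fin_supp_inj (k : nat) (x : V k) : fin_supp (dfwith (fun j => 0 : V j) x).
Proof.
exists k.+1 => j kj; rewrite dfwith_out //.
by apply/eqP => kj'; rewrite kj' ltnn in kj.
Qed.

Definition dsum0 := Dsum fin_supp0.
Definition dsum_add (f g : dsum) := Dsum (fin_suppD f g).
Definition dsum_opp (f : dsum) := Dsum (fin_suppN f).
Definition dsum_scale (a : M) (f : dsum) := Dsum (fin_suppZ a f).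
Definition dsum_inj (k : nat) (x : V k) : dsum := Dsum (fin_supp_inj x).

Lemma dsum_addA : associative dsum_add.
Proof. by move=> f g h; apply: dsumP => k; apply: addrA. Qed.
Lemma dsum_addC : commutative dsum_add.
Proof. by move=> f g; apply: dsumP => k; apply: addrC. Qed.
Lemma dsum_add0 : left_id dsum0 dsum_add.
Proof. by move=> f; apply: dsumP => k; apply: add0r. Qed.
Lemma dsum_addN : left_inverse dsum0 dsum_opp dsum_add.
Proof. by move=> f; apply: dsumP => k; apply: addNr. Qed.
HB.instance Definition _ :=
  GRing.isZmodule.Build dsum dsum_addA dsum_addC dsum_add0 dsum_addN.

Lemma dsum_scaleA a b f : dsum_scale a (dsum_scale b f) = dsum_scale (a * b) f.
Proof. by apply: dsumP => k; apply: scalerA. Qed.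
Lemma dsum_scale1 : left_id 1 dsum_scale.
Proof. by move=> f; apply: dsumP => k; apply: scale1r. Qed.
Lemma dsum_scaleDr : right_distributive dsum_scale +%R.
Proof. by move=> a f g; apply: dsumP => k; apply: scalerDr. Qed.
Lemma dsum_scaleDl f : {morph dsum_scale^~ f : a b / a + b}.
Proof. by move=> a b; apply: dsumP => k; apply: scalerDl. Qed.
HB.instance Definition _ := GRing.Zmodule_isLmodule.Build M dsum
  dsum_scaleA dsum_scale1 dsum_scaleDr dsum_scaleDl.
End DirectSum.

(* Bigraded left comodules over a Hopf algebroid (M, E) with right unit etaR:
   a left M-module with its homogeneous elements in each bidegree and its
   coaction.  Only these data, not the counit and coassociativity laws, enter
   the notion of isomorphism. *)
Section Comodule.
Variables (M E : pzRingType) (etaR : {rmorphism M -> E}).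

Record comodule : Type := Comodule {
  cm_car :> lmodType M;
  cm_homog : int * int -> cm_car -> Prop;
  cm_coact : cm_car -> tensor etaR cm_car }.

Definition comodule_iso (C D : comodule) : Prop :=
  exists f : {linear C -> D},
    [/\ bijective f,
        forall d (x : C), cm_homog d x <-> cm_homog d (f x) &
        forall x : C, cm_coact (f x) = tmap etaR etaR id f (cm_coact x)].

(* Restriction of the coaction to a submodule S; the lift of the coaction along
   E \otimes S -> E \otimes C is unique as soon as E is flat as a right
   M-module. *)
Definition subcomodule (C : comodule) (S : submodule C)
    (HS : forall x : sub_car S, exists t : tensor etaR (sub_car S),
       tmap etaR etaR id (@sub_val _ _ S) t = cm_coact (sub_val x)) :=
  @Comodule (sub_car S) (fun d x => cm_homog d (sub_val x))
            (fun x => sval (cid (HS x))).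

(* The suspension \Sigma^{2a, b}: an even number of circles introduces no sign
   in the module structure or in the coaction. *)
Definition even_shift (a b : int) (C : comodule) : comodule :=
  @Comodule C (fun d x => cm_homog (d.1 - a *+ 2, d.2 - b) x) (@cm_coact C).

(* The sum runs up to any bound of the support of f. *)
Definition dsum_coact (C : nat -> comodule) (f : dsum C) :
    tensor etaR (dsum C) :=
  \sum_(k < sval (cid (dsum_fin f)))
    tmap etaR etaR id (@dsum_inj _ C k) (cm_coact (f k)).

Definition dsum_comodule (C : nat -> comodule) : comodule :=
  @Comodule (dsum C) (fun d f => forall k, cm_homog d (f k)) (@dsum_coact C).
End Comodule.

(* F_p-algebras presented by graded commutative generators; odd records the
   parity of the first (topological) degree, which alone governs signs. *)
Definition rsign (G : Type) (b : bool) (s : rexpr G) : rexpr G :=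
  if b then (- s)%rx else s.

Fixpoint rnat (G : Type) (n : nat) : rexpr G :=
  if n is n'.+1 then (1 + rnat G n')%rx else 0%rx.

Section GradedCommutative.
Variables (G : Type) (odd : G -> bool) (p : nat).
Variable extra : rexpr G -> rexpr G -> Prop.

Inductive gcrel : rexpr G -> rexpr G -> Prop :=
| gc_char : gcrel (rnat G p) 0%rx
| gc_comm g h :
    gcrel (RGen g * RGen h)%rx (rsign (odd g && odd h) (RGen h * RGen g)%rx)
| gc_extra s t : extra s t -> gcrel s t.

Lemma reval_rnat (R : pzRingType) (v : G -> R) n : reval v (rnat G n) = n%:R.
Proof. by elim: n => //= n ->; rewrite -natr1 addrC. Qed.

Lemma reval_rsign (R : pzRingType) (v : G -> R) b s :
  reval v (rsign b s) = (-1) ^+ b * reval v s.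
Proof. by case: b; rewrite /= ?mul1r // expr1 mulN1r. Qed.

Let P := presented gcrel.

Lemma gc_charE : p%:R = 0 :> P.
Proof. by have := presented_rel gc_char; rewrite reval_rnat. Qed.

Lemma gc_commE g h :
  gen gcrel g * gen gcrel h =
  (-1) ^+ (odd g && odd h) * (gen gcrel h * gen gcrel g) :> P.
Proof. by have /= -> := presented_rel (gc_comm g h); rewrite reval_rsign. Qed.

(* The grading involution x |-> (-1)^|x| x. *)
Definition gcinv_gen (g : G) : P := (-1) ^+ odd g * gen gcrel g.
Definition gcinv : P -> P := rlift gcinv_gen.

Hypothesis extra_inv :
  forall s t, extra s t -> reval gcinv_gen s = reval gcinv_gen t.

Lemma gcinv_sat s t : gcrel s t -> reval gcinv_gen s = reval gcinv_gen t.
Proof.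
have sC (x : P) (b : bool) : x * (-1) ^+ b = (-1) ^+ b * x.
  by rewrite commr_sign.
case=> {s t} [|g h|]; last exact: extra_inv.
  by rewrite reval_rnat gc_charE.
rewrite reval_rsign /= /gcinv_gen -!mulrA [gen _ g * _]mulrA sC.
rewrite [gen _ h * (_ * _)]mulrA sC -!mulrA gc_commE !mulrA; congr (_ * _).
by rewrite -!signr_addb; case: (odd g); case: (odd h).
Qed.

Let gcinvB : zmod_morphism gcinv := rlift_zmod gcinv_sat.
Let gcinvM : monoid_morphism gcinv := rlift_monoid gcinv_sat.

Lemma gcinv_genE g : gcinv (gen gcrel g) = (-1) ^+ odd g * gen gcrel g.
Proof. exact: (rlift_gen gcinv_sat). Qed.

Lemma gcinv0 : gcinv 0 = 0.
Proof. by rewrite -{1}(subrr 0) gcinvB subrr. Qed.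

Lemma gcinvN x : gcinv (- x) = - gcinv x.
Proof. by rewrite -[- x]add0r gcinvB gcinv0 add0r. Qed.

Lemma gcinvD x y : gcinv (x + y) = gcinv x + gcinv y.
Proof. by rewrite -{1}[y]opprK gcinvB gcinvN opprK. Qed.

Lemma gcinvK : involutive gcinv.
Proof.
elim/presented_ind.
- move=> g; rewrite gcinv_genE gcinvM.2 gcinv_genE.
  case: (odd g); rewrite ?expr0 ?expr1 ?gcinvM.1 ?mul1r //.
  by rewrite gcinvN gcinvM.1 mulrA mulrNN !mul1r.
- by rewrite !gcinv0.
- by rewrite !gcinvM.1.
- by move=> x IH; rewrite !gcinvN IH.
- by move=> x y IHx IHy; rewrite !gcinvD IHx IHy.
- by move=> x y IHx IHy; rewrite !gcinvM.2 IHx IHy.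
Qed.

Lemma gen_swap g (x : P) :
  gen gcrel g * x = (if odd g then gcinv x else x) * gen gcrel g.
Proof.
elim/presented_ind: x.
- move=> h; rewrite gc_commE gcinv_genE.
  by case: (odd g); rewrite ?mul1r //= mulrA.
- by rewrite gcinv0 if_same mulr0 mul0r.
- by rewrite gcinvM.1 if_same mulr1 mul1r.
- move=> x; rewrite mulrN => ->.
  by case: (odd g); rewrite ?gcinvN mulNr.
- move=> x y IHx IHy; rewrite mulrDr IHx IHy -mulrDl.
  by case: (odd g); rewrite ?gcinvD.
- move=> x y IHx IHy; rewrite mulrA IHx -mulrA IHy mulrA.
  by case: (odd g); rewrite ?gcinvM.2.
Qed.
End GradedCommutative.

(* The base fields C, R and F_q (a finite field K, with q = #|K|). *)
Inductive base : Type :=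
| BaseC
| BaseR
| BaseFq of finFieldType.

Definition char_neq (F : base) (p : nat) : bool :=
  if F is BaseFq K then p \notin [pchar K] else true.

Inductive Mgen : Type := Theta | Gam.

Inductive Agen : Type :=
| Coef of Mgen
| Tau of nat
| Xi of nat. (* Xi i stands for \bar\xi_{i+1} *)

Definition Mgen_code (c : Mgen) : bool := if c is Theta then true else false.
Lemma Mgen_codeK :
  cancel Mgen_code (fun b : bool => if b then Theta else Gam).
Proof. by case. Qed.
HB.instance Definition _ := Equality.copy Mgen (can_type Mgen_codeK).

Definition Agen_code (g : Agen) : (Mgen + (nat + nat))%type :=
  match g with
  | Coef c => inl c
  | Tau i => inr (inl i)
  | Xi i => inr (inr i)
  end.
Lemma Agen_codeK : cancel Agen_code (fun c => match c with
  | inl c => Coef c | inr (inl i) => Tau i | inr (inr i) => Xi i end).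
Proof. by case. Qed.
HB.instance Definition _ := Equality.copy Agen (can_type Agen_codeK).

Section DualSteenrod.
Variables (p : nat) (F : base).

(* By the Beilinson-Lichtenbaum conjecture the coefficient ring is
     (M_p)_{-s,-w} = H^s(F; mu_p^{\otimes w}) for s <= w, and 0 otherwise.
   For C, R and F_q it is generated over F_p by a class Theta in degree
   (0, -twist), where twist is the order of the cyclotomic action on mu_p,
   and a class Gam in degree (-1, -twist):
     C            : F_p[tau],             Theta = tau;
     R, p = 2     : F_2[tau, rho],        Theta = tau, Gam = rho;
     R, p odd     : F_p[tau^2],           Theta = tau^2;
     F_q          : F_p[Theta, Gam]/Gam^2. *)
Definition twist : nat :=
  match F with
  | BaseC => 1
  | BaseR => if p == 2%N then 1 else 2
  | BaseFq K => (find (fun d => #|K| ^ d.+1 == 1 %[mod p])%N (iota 0 p)).+1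
  end.

Definition has_gam : bool :=
  match F with BaseC => false | BaseR => p == 2%N | BaseFq _ => true end.

Definition gam_sq0 : bool := if F is BaseFq _ then true else false.

(* Whether the Bockstein of Theta is nonzero, in which case Gam is normalized
   to be that Bockstein; over F_q it vanishes iff Theta lifts to
   H^0(F_q; mu_{p^2}^{\otimes twist}).  For p = 2 it is rho = [-1], which over
   F_q is nonzero iff q = 3 mod 4. *)
Definition has_bock : bool :=
  match F with
  | BaseC => false
  | BaseR => p == 2%N
  | BaseFq K => ~~ (p ^ 2 %| #|K| ^ twist - 1)%N
  end.

Definition bock : rexpr Mgen := if has_bock then RGen Gam else 0%rx.

Definition Modd (c : Mgen) : bool := if c is Gam then true else false.

Inductive Mextra : rexpr Mgen -> rexpr Mgen -> Prop :=
| Mextra_gam : ~~ has_gam -> Mextra (RGen Gam) 0%rx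
| Mextra_gam2 : gam_sq0 -> Mextra (RGen Gam * RGen Gam)%rx 0%rx.

Definition Mrel := gcrel Modd p Mextra.
Definition Mp : Type := presented Mrel.
HB.instance Definition _ := GRing.PzRing.on Mp.

Definition Aodd (g : Agen) : bool :=
  match g with Coef c => Modd c | Tau _ => true | Xi _ => false end.

(* In terms of the conjugates \bar\tau_i, \bar\xi_i, Voevodsky's relation
   \tau_i^2 = \tau \xi_{i+1} + \rho \tau_{i+1} + \rho \tau_0 \xi_{i+1} at p = 2
   loses its last term, since conjugation sends \tau to
   \tau + \rho \bar\tau_0. *)
Inductive Aextra : rexpr Agen -> rexpr Agen -> Prop :=
| Aextra_coef s t : Mextra s t -> Aextra (rmap Coef s) (rmap Coef t)
| Aextra_tau2 i : p = 2%N ->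
    Aextra (RGen (Tau i) * RGen (Tau i))%rx
           (RGen (Coef Theta) * RGen (Xi i) +
            rmap Coef bock * RGen (Tau i.+1))%rx
| Aextra_tau0 i : p <> 2%N -> Aextra (RGen (Tau i) * RGen (Tau i))%rx 0%rx.

Definition Arel := gcrel Aodd p Aextra.
Definition Ap : Type := presented Arel.
HB.instance Definition _ := GRing.PzRing.on Ap.

(* The quotient E(n)^\vee = A^\vee/(\bar\xi_i, i >= 1; \bar\tau_j, j > n). *)
Inductive Eextra (n : int) : rexpr Agen -> rexpr Agen -> Prop :=
| Eextra_A s t : Aextra s t -> Eextra n s t
| Eextra_xi i : Eextra n (RGen (Xi i)) 0%rx
| Eextra_tau (j : nat) : n < j%:Z -> Eextra n (RGen (Tau j)) 0%rx.

Definition Erel n := gcrel Aodd p (Eextra n).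
Definition Ep (n : int) : Type := presented (Erel n).
HB.instance Definition _ n := GRing.PzRing.on (Ep n).

Definition coef (c : Mgen) : Ap := gen Arel (Coef c).
Definition taub (i : nat) : Ap := gen Arel (Tau i).
Definition xib (i : nat) : Ap := if i is i'.+1 then gen Arel (Xi i') else 1.
Definition bockA : Ap := if has_bock then coef Gam else 0.

Lemma reval_rmap (R : pzRingType) (G G' : Type) (f : G -> G') (v : G' -> R) s :
  reval v (rmap f s) = reval (v \o f) s.
Proof. by elim: s => //= [s ->|s -> t ->|s -> t ->]. Qed.

Lemma Aextra_rel s t : Aextra s t -> reval (gen Arel) s = reval (gen Arel) t.
Proof. by move=> st; apply: presented_rel; apply: gc_extra. Qed.

Lemma reval_bock (R : pzRingType) (v : Mgen -> R) :
  reval v bock = if has_bock then v Gam else 0.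
Proof. by rewrite /bock; case: has_bock. Qed.

Lemma sat_gcrel (R : pzRingType) (G : Type) (odd : G -> bool) extra
    (v : G -> R) :
  p%:R = 0 :> R ->
  (forall g h, v g * v h = (-1) ^+ (odd g && odd h) * (v h * v g)) ->
  (forall s t, extra s t -> reval v s = reval v t) ->
  forall s t, gcrel odd p extra s t -> reval v s = reval v t.
Proof.
move=> p0 vC vE s t [|g h|{}s {}t st]; first by rewrite reval_rnat.
- by rewrite reval_rsign /= vC.
- exact: vE.
Qed.

Lemma Ap_char : p%:R = 0 :> Ap. Proof. exact: gc_charE. Qed.

Lemma coef_gam : ~~ has_gam -> coef Gam = 0.
Proof. by move=> h; have /= := Aextra_rel (Aextra_coef (Mextra_gam h)). Qed.

Lemma coef_gam2 : gam_sq0 -> coef Gam * coef Gam = 0.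
Proof. by move=> h; have /= := Aextra_rel (Aextra_coef (Mextra_gam2 h)). Qed.

Lemma etaL_sat s t :
  Mrel s t -> reval (gen Arel \o Coef) s = reval (gen Arel \o Coef) t.
Proof.
apply: sat_gcrel; first exact: Ap_char.
- by move=> c d; rewrite /= gc_commE.
- move=> {}s {}t st; rewrite -2!(reval_rmap Coef).
  by apply: Aextra_rel; constructor.
Qed.

Definition etaL : Mp -> Ap := rlift (gen Arel \o Coef).
HB.instance Definition _ := GRing.isZmodMorphism.Build Mp Ap etaL
  (rlift_zmod etaL_sat).
HB.instance Definition _ := GRing.isMonoidMorphism.Build Mp Ap etaL
  (rlift_monoid etaL_sat).

Definition etaR_gen (c : Mgen) : Ap :=
  if c is Theta then coef Theta + bockA * taub 0 else coef Gam.

Lemma etaR_sat s t : Mrel s t -> reval etaR_gen s = reval etaR_gen t.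
Proof.
have TG : coef Theta * coef Gam = coef Gam * coef Theta.
  by rewrite /coef gc_commE mul1r.
have Gt : taub 0 * coef Gam = - (coef Gam * taub 0).
  by rewrite /coef /taub gc_commE /= expr1 mulN1r.
have GG : coef Gam * coef Gam = - (coef Gam * coef Gam).
  by rewrite /coef {1}gc_commE /= expr1 mulN1r.
have com : coef Gam * bockA * taub 0 = bockA * taub 0 * coef Gam.
  rewrite /bockA; case: has_bock; last by rewrite !(mulr0, mul0r).
  rewrite -[RHS]mulrA Gt mulrN mulrA. rewrite -mulNr. by rewrite -GG.
apply: sat_gcrel; first exact: Ap_char.
- case; case; rewrite /= ?expr0 ?mul1r ?expr1 ?mulN1r //.
  + by rewrite mulrDl mulrDr TG mulrA com.
  + by rewrite mulrDl mulrDr TG mulrA com.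
- by move=> _ _ [/coef_gam|/coef_gam2].
Qed.

(* On the generators the right unit only sees the Bockstein: the higher
   Milnor primitives and the reduced powers vanish on Theta and Gam, since
   H^s(F; mu_p^{\otimes w}) vanishes in the relevant degrees. *)
Definition etaR : Mp -> Ap := rlift etaR_gen.
HB.instance Definition _ := GRing.isZmodMorphism.Build Mp Ap etaR
  (rlift_zmod etaR_sat).
HB.instance Definition _ := GRing.isMonoidMorphism.Build Mp Ap etaR
  (rlift_monoid etaR_sat).

Lemma projE_sat n s t :
  Arel s t -> reval (gen (Erel n)) s = reval (gen (Erel n)) t.
Proof.
apply: sat_gcrel; first exact: gc_charE.
- by move=> g h; apply: gc_commE.
- by move=> {}s {}t st; apply/presented_rel/gc_extra/Eextra_A.
Qed.

Definition projE (n : int) : Ap -> Ep n := rlift (gen (Erel n)).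
HB.instance Definition _ n := GRing.isZmodMorphism.Build Ap (Ep n) (projE n)
  (rlift_zmod (@projE_sat n)).
HB.instance Definition _ n := GRing.isMonoidMorphism.Build Ap (Ep n) (projE n)
  (rlift_monoid (@projE_sat n)).

Definition etaRE (n : int) : {rmorphism Mp -> Ep n} := projE n \o etaR.

Definition Ascale (m : Mp) (x : Ap) : Ap := etaL m * x.

Lemma AscaleA a b x : Ascale a (Ascale b x) = Ascale (a * b) x.
Proof. by rewrite /Ascale rmorphM mulrA. Qed.
Lemma Ascale1 : left_id 1 Ascale.
Proof. by move=> x; rewrite /Ascale rmorph1 mul1r. Qed.
Lemma AscaleDr : right_distributive Ascale +%R.
Proof. by move=> a x y; rewrite /Ascale mulrDr. Qed.
Lemma AscaleDl x : {morph Ascale^~ x : a b / a + b}.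
Proof. by move=> a b; rewrite /Ascale rmorphD mulrDl. Qed.

HB.instance Definition _ := GRing.Zmodule_isLmodule.Build Mp Ap
  AscaleA Ascale1 AscaleDr AscaleDl.

Lemma ApZ (m : Mp) (x : Ap) : m *: x = etaL m * x. Proof. by []. Qed.

Lemma Mextra_inv s t : Mextra s t ->
  reval (gcinv_gen Modd p Mextra) s = reval (gcinv_gen Modd p Mextra) t.
Proof.
have E u v : Mextra u v -> reval (gen Mrel) u = reval (gen Mrel) v.
  by move=> uv; apply: presented_rel; apply: gc_extra.
case=> [h|h] /=; rewrite /gcinv_gen /= expr1.
  by have /= -> := E _ _ (Mextra_gam h); rewrite mulr0.
by have /= := E _ _ (Mextra_gam2 h); rewrite !mulN1r mulrNN.
Qed.

Lemma Ap_oppr2 : p = 2%N -> forall x : Ap, - x = x.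
Proof.
move=> p2 x; apply/eqP; rewrite -subr_eq0 -opprD oppr_eq0 -mulr2n.
by rewrite -mulr_natr -p2 Ap_char mulr0.
Qed.

Lemma Aextra_inv s t : Aextra s t ->
  reval (gcinv_gen Aodd p Aextra) s = reval (gcinv_gen Aodd p Aextra) t.
Proof.
case=> {s t} [s t [h|h]|i p2|i p2] /=; rewrite /gcinv_gen /= ?expr1 ?expr0.
- by rewrite -/(coef Gam) coef_gam // mulr0.
- by rewrite !mulN1r mulrNN -/(coef Gam) coef_gam2.
- rewrite reval_rmap reval_bock /= ?expr0 ?mul1r !mulN1r mulrNN.
  have /= -> := Aextra_rel (Aextra_tau2 i p2).
  by rewrite reval_rmap reval_bock /= mulrN !(Ap_oppr2 p2).
- by rewrite !mulN1r mulrNN; have /= -> := Aextra_rel (Aextra_tau0 i p2).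
Qed.

(* The grading involutions x |-> (-1)^|x| x of M_p and of A_p^\vee. *)
Definition Minv : Mp -> Mp := gcinv (extra := Mextra).
Definition Ainv : Ap -> Ap := gcinv (extra := Aextra).

Lemma Ainv_zmod : zmod_morphism Ainv.
Proof. exact: (rlift_zmod (gcinv_sat Aextra_inv)). Qed.
Lemma Ainv_monoid : monoid_morphism Ainv.
Proof. exact: (rlift_monoid (gcinv_sat Aextra_inv)). Qed.
HB.instance Definition _ := GRing.isZmodMorphism.Build Ap Ap Ainv Ainv_zmod.
HB.instance Definition _ := GRing.isMonoidMorphism.Build Ap Ap Ainv Ainv_monoid.

Lemma Minv_zmod : zmod_morphism Minv.
Proof. exact: (rlift_zmod (gcinv_sat Mextra_inv)). Qed.
Lemma Minv_monoid : monoid_morphism Minv.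
Proof. exact: (rlift_monoid (gcinv_sat Mextra_inv)). Qed.
HB.instance Definition _ := GRing.isZmodMorphism.Build Mp Mp Minv Minv_zmod.
HB.instance Definition _ := GRing.isMonoidMorphism.Build Mp Mp Minv Minv_monoid.

Lemma Ainv_gen g : Ainv (gen Arel g) = (-1) ^+ Aodd g * gen Arel g.
Proof. exact: gcinv_genE Aextra_inv g. Qed.
Lemma Minv_gen c : Minv (gen Mrel c) = (-1) ^+ Modd c * gen Mrel c.
Proof. exact: gcinv_genE Mextra_inv c. Qed.
Lemma AinvK : involutive Ainv. Proof. exact: (gcinvK Aextra_inv). Qed.

Lemma etaL_gen c : etaL (gen Mrel c) = coef c.
Proof. exact: (rlift_gen etaL_sat). Qed.
Lemma etaR_genE c : etaR (gen Mrel c) = etaR_gen c.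
Proof. exact: (rlift_gen etaR_sat). Qed.

Lemma Ainv_etaL m : Ainv (etaL m) = etaL (Minv m).
Proof.
elim/presented_ind: m.
- move=> c; by rewrite etaL_gen Ainv_gen Minv_gen rmorphM rmorph_sign /= etaL_gen.
- by rewrite !rmorph0.
- by rewrite !rmorph1.
- by move=> x IH; rewrite !rmorphN /= IH.
- by move=> x y IHx IHy; rewrite !rmorphD /= IHx IHy.
- by move=> x y IHx IHy; rewrite !rmorphM /= IHx IHy.
Qed.

Lemma Ainv_etaR m : Ainv (etaR m) = etaR (Minv m).
Proof.
elim/presented_ind: m.
- move=> c; rewrite etaR_genE Minv_gen rmorphM rmorph_sign /= etaR_genE.
  case: c; rewrite /= ?expr0 ?mul1r; last by rewrite Ainv_gen.
  rewrite rmorphD rmorphM /= !Ainv_gen /= expr0 mul1r; congr (_ + _).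
  rewrite /bockA; case: has_bock; last by rewrite rmorph0 !mul0r.
  by rewrite Ainv_gen /= !expr1 !mulN1r mulrNN.
- by rewrite !rmorph0.
- by rewrite !rmorph1.
- by move=> x IH; rewrite !rmorphN /= IH.
- by move=> x y IHx IHy; rewrite !rmorphD /= IHx IHy.
- by move=> x y IHx IHy; rewrite !rmorphM /= IHx IHy.
Qed.

Lemma taub_swap k (x : Ap) : taub k * x = Ainv x * taub k.
Proof. exact: gen_swap Aextra_inv (Tau k) x. Qed.

Definition central (y : Ap) : Prop := forall x : Ap, y * x = x * y.

Lemma central1 : central 1. Proof. by move=> x; rewrite mul1r mulr1. Qed.
Lemma centralM y z : central y -> central z -> central (y * z).
Proof. by move=> Cy Cz x; rewrite -mulrA Cz mulrA Cy mulrA. Qed.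
Lemma centralX y n : central y -> central (y ^+ n).
Proof.
move=> Cy; elim: n => [|n IH]; first by rewrite expr0; apply: central1.
by rewrite exprS; apply: centralM.
Qed.
Lemma central_xib i : central (xib i).
Proof.
case: i => [|i]; first exact: central1.
by move=> x; apply: gen_swap Aextra_inv (Xi i) x.
Qed.
Lemma central_xibX i n : central (xib i ^+ n).
Proof. exact/centralX/central_xib. Qed.
Lemma Ainv_p2 : p = 2%N -> forall z, Ainv z = z.
Proof.
move=> p2; elim/presented_ind=> [g|||z IH|z t IHz IHt|z t IHz IHt].
- by rewrite Ainv_gen; case: Aodd; rewrite ?mul1r //= mulN1r Ap_oppr2.
- by rewrite rmorph0.
- by rewrite rmorph1.
- by rewrite rmorphN /= IH.
- by rewrite rmorphD /= IHz IHt.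
- by rewrite rmorphM /= IHz IHt.
Qed.
Lemma central_p2 : p = 2%N -> forall y, central y.
Proof.
move=> p2 y x; elim/presented_ind: y => [g|||z IH|z t IHz IHt|z t IHz IHt].
- by rewrite (gen_swap Aextra_inv) -/Ainv (Ainv_p2 p2) if_same.
- by rewrite mulr0 mul0r.
- by rewrite mulr1 mul1r.
- by rewrite mulrN mulNr IH.
- by rewrite mulrDl mulrDr IHz IHt.
- by rewrite mulrA -IHz -!mulrA IHt.
Qed.

Local Notation etaRm := (etaR : {rmorphism Mp -> Ap}).
Local Notation AA := (tensor etaRm Ap).
Local Notation "x @ y" := (tens (N := Ap) etaRm x y) (at level 42).

(* The coproduct A -> A \otimes_M A is multiplicative for the Koszul product
   (x @ y)(x' @ y') = (-1)^{|y||x'|} xx' @ yy', so it is determined by the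
   additive operators coprod_op g, left multiplication by psi(g), on the
   generators g, with
     psi(\bar\tau_k) = 1 @ \bar\tau_k + \sum_{i+j=k} \bar\tau_i @ \bar\xi_j^{p^i},
     psi(\bar\xi_k) = \sum_{i+j=k} \bar\xi_i @ \bar\xi_j^{p^i}.
   The sign only enters the product with 1 @ \bar\tau_k, through Ainv, as the
   \bar\xi_j have even degree. *)
Definition lmul (x y : Ap) : AA -> AA := tmap etaRm etaRm (fun e => x * e) (fun n => y * n).
Definition lmul_tau (k : nat) : AA -> AA :=
  tmap etaRm etaRm Ainv (fun n => taub k * n).

Definition coprod_op (g : Agen) (t : AA) : AA :=
  match g with
  | Coef c => lmul (coef c) 1 t
  | Tau k => lmul_tau k t
             + \sum_(i < k.+1) lmul (taub i) (xib (k - i) ^+ (p ^ i)) t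
  | Xi k => \sum_(i < k.+2) lmul (xib i) (xib (k.+1 - i) ^+ (p ^ i)) t
  end.

Definition coprod (x : Ap) : AA := ract coprod_op (repr x) (1 @ 1).

Lemma lmul_bimap x y : central y ->
  bimap etaRm etaRm (fun e : Ap => x * e) (fun n : Ap => y * n).
Proof.
move=> Cy; split=> [e e'|n n'|e m n]; rewrite ?mulrDr //.
by rewrite /= [x * _]mulrA tens_bal !ApZ !mulrA Cy.
Qed.

Lemma lmul_tau_bimap k :
  bimap etaRm etaRm Ainv (fun n : Ap => taub k * n).
Proof.
split=> [e e'|n n'|e m n]; rewrite ?mulrDr ?rmorphD //.
rewrite rmorphM /= Ainv_etaR tens_bal !ApZ [in RHS]mulrA.
by rewrite [taub k * etaL m]taub_swap Ainv_etaL mulrA.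
Qed.

Lemma lmul_tens x y : central y -> forall e n, lmul x y (e @ n) = (x * e) @ (y * n).
Proof. by move=> Cy e n; apply: (tmap_tens (lmul_bimap x Cy)). Qed.
Lemma lmulB x y : central y -> zmod_morphism (lmul x y).
Proof. by move=> Cy; apply: (tmap_zmod (lmul_bimap x Cy)). Qed.
Lemma lmul_tau_tens k e n : lmul_tau k (e @ n) = Ainv e @ (taub k * n).
Proof. exact: (tmap_tens (lmul_tau_bimap k)). Qed.
Lemma lmul_tauB k : zmod_morphism (lmul_tau k).
Proof. exact: (tmap_zmod (lmul_tau_bimap k)). Qed.

Lemma sumB (V W : zmodType) n (f : 'I_n -> V -> W) :
  (forall i, zmod_morphism (f i)) -> zmod_morphism (fun t => \sum_i f i t).
Proof. by move=> fB x y; rewrite -sumrB; apply: eq_bigr => i _; apply: fB. Qed.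

Lemma addB (V W : zmodType) (f g : V -> W) :
  zmod_morphism f -> zmod_morphism g -> zmod_morphism (fun t => f t + g t).
Proof. by move=> fB gB x y; rewrite fB gB opprD addrACA. Qed.

Lemma lmul_sumB n (x y : nat -> Ap) : (forall i, central (y i)) ->
  zmod_morphism (fun t => \sum_(i < n) lmul (x i) (y i) t).
Proof. by move=> Cy; apply: sumB => i; apply: lmulB. Qed.

Lemma coprod_opB g : zmod_morphism (coprod_op g).
Proof.
case: g => [c|k|k]; first exact: (lmulB _ central1).
- apply: (addB (lmul_tauB k)).
  apply: (@lmul_sumB k.+1 taub (fun i => xib (k - i) ^+ (p ^ i))) => i.
  exact: central_xibX.
- apply: (@lmul_sumB k.+2 xib (fun i => xib (k.+1 - i) ^+ (p ^ i))) => i.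
  exact: central_xibX.
Qed.

Definition sg (V : zmodType) (b : bool) (t : V) : V := if b then - t else t.

Lemma sgE (b : bool) (x : Ap) : (-1) ^+ b * x = sg b x.
Proof. by case: b; rewrite ?mulN1r ?mul1r. Qed.

Lemma sg_sum (V : zmodType) b n (f : 'I_n -> V) :
  \sum_i sg b (f i) = sg b (\sum_i f i).
Proof. by case: b => //=; rewrite sumrN. Qed.

Lemma sgD (V : zmodType) b (x y : V) : sg b (x + y) = sg b x + sg b y.
Proof. by case: b => //=; rewrite opprD. Qed.

Lemma sgK (V : zmodType) b (x : V) : sg b (sg b x) = x.
Proof. by case: b; rewrite //= opprK. Qed.

Section ZmodMorph.
Variables (V W : zmodType) (f : V -> W) (fB : zmod_morphism f).
Lemma zm0 : f 0 = 0. Proof. by rewrite -{1}(subrr 0) fB subrr. Qed.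
Lemma zmN x : f (- x) = - f x.
Proof. by rewrite -[- x]add0r fB zm0 add0r. Qed.
Lemma zmD x y : f (x + y) = f x + f y.
Proof. by rewrite -{1}[y]opprK fB zmN opprK. Qed.
Lemma zm_sum n (g : 'I_n -> V) : f (\sum_i g i) = \sum_i f (g i).
Proof.
elim: n g => [|n IH] g; first by rewrite !big_ord0 zm0.
by rewrite !big_ord_recl zmD IH.
Qed.
Lemma zm_sg b x : f (sg b x) = sg b (f x).
Proof. by case: b => //=; rewrite zmN. Qed.
End ZmodMorph.

Lemma sgB (V : zmodType) b : zmod_morphism (@sg V b).
Proof. by case: b => x y /=; rewrite ?opprD. Qed.

Lemma compB (U V W : zmodType) (f : V -> W) (g : U -> V) :
  zmod_morphism f -> zmod_morphism g -> zmod_morphism (fun t => f (g t)).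
Proof. by move=> fB gB x y; rewrite gB fB. Qed.

Lemma tens_ext (V : zmodType) (f g : AA -> V) :
  zmod_morphism f -> zmod_morphism g -> (forall e n, f (e @ n) = g (e @ n)) ->
  f =1 g.
Proof.
move=> fB gB fg; elim/tensor_ind=> // [|x IH|x y IHx IHy].
- by rewrite (zm0 fB) (zm0 gB).
- by rewrite (zmN fB) (zmN gB) IH.
- by rewrite (zmD fB) (zmD gB) IHx IHy.
Qed.

Lemma sg_tensl b e n : sg b e @ n = sg b (e @ n).
Proof. by case: b => //=; rewrite tensNl. Qed.
Lemma sg_tensr b e n : e @ sg b n = sg b (e @ n).
Proof. by case: b => //=; rewrite tensNr. Qed.
Lemma sg_mull b (x y : Ap) : sg b x * y = sg b (x * y).
Proof. by case: b => //=; rewrite mulNr. Qed.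

Lemma lmulC b x y x' y' t : central y -> central y' ->
  x * x' = sg b (x' * x) ->
  lmul x y (lmul x' y' t) = sg b (lmul x' y' (lmul x y t)).
Proof.
move=> Cy Cy' xx'; have LB := @lmulB _ _ Cy; have LB' := @lmulB _ _ Cy'.
apply: (tens_ext (compB (LB x) (LB' x'))
                 (compB (@sgB _ b) (compB (LB' x') (LB x)))) t => e n.
by rewrite !lmul_tens // !mulrA xx' sg_mull sg_tensl (Cy y').
Qed.

Lemma lmul_tauC b k x y t : central y -> Ainv x = sg b x ->
  lmul_tau k (lmul x y t) = sg b (lmul x y (lmul_tau k t)).
Proof.
move=> Cy xb; have LB := @lmulB _ _ Cy; have SB := lmul_tauB k.
apply: (tens_ext (compB SB (LB x)) (compB (@sgB _ b) (compB (LB x) SB))) t.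
move=> e n; rewrite !(lmul_tau_tens, lmul_tens) // rmorphM /= xb sg_mull.
by rewrite sg_tensl !mulrA (Cy (taub k)).
Qed.

Lemma taubC k l : taub k * taub l = - (taub l * taub k).
Proof. by rewrite /taub gc_commE /= expr1 mulN1r. Qed.

Lemma lmul_tau2 k l t :
  lmul_tau k (lmul_tau l t) = - lmul_tau l (lmul_tau k t).
Proof.
have kB := lmul_tauB k; have lB := lmul_tauB l.
apply: (tens_ext (compB kB lB) (compB (@sgB _ true) (compB lB kB))) t => e n /=.
by rewrite !lmul_tau_tens !mulrA taubC mulNr tensNr.
Qed.

(* coprod_op g is lmul_tau (for g = Tau k) plus the sum of the
   lmul (opx g i) (opy g i). *)
Definition opn (g : Agen) : nat :=
  match g with Coef _ => 1 | Tau k => k.+1 | Xi k => k.+2 end.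
Definition opx (g : Agen) (i : nat) : Ap :=
  match g with Coef c => coef c | Tau k => taub i | Xi k => xib i end.
Definition opy (g : Agen) (i : nat) : Ap :=
  match g with
  | Coef c => 1
  | Tau k => xib (k - i) ^+ (p ^ i)
  | Xi k => xib (k.+1 - i) ^+ (p ^ i)
  end.
Definition opS (g : Agen) (t : AA) : AA :=
  if g is Tau k then lmul_tau k t else 0.
Definition opL (g : Agen) (t : AA) : AA :=
  \sum_(i < opn g) lmul (opx g i) (opy g i) t.

Lemma central_opy g i : central (opy g i).
Proof.
by case: g => [c|k|k]; [apply: central1 | apply: central_xibX..].
Qed.

Lemma coprod_opE g t : coprod_op g t = opS g t + opL g t.
Proof. by case: g => [c|k|k]; rewrite /opL /= ?add0r // big_ord1. Qed.

Lemma opLB g : zmod_morphism (opL g).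
Proof. by apply: lmul_sumB => i; apply: central_opy. Qed.

Lemma opSB g : zmod_morphism (opS g).
Proof.
by case: g => [c|k|k] x y /=; rewrite ?subr0 //; apply: lmul_tauB.
Qed.

Lemma opxC g h i j :
  opx g i * opx h j = sg (Aodd g && Aodd h) (opx h j * opx g i).
Proof.
have gC u v : gen Arel u * gen Arel v =
    sg (Aodd u && Aodd v) (gen Arel v * gen Arel u).
  by rewrite gc_commE sgE.
have xC k x : x * xib k = xib k * x by rewrite central_xib.
have fT := andbF; case: g h => [c|k|k] [d|l|l] /=; rewrite ?andbF.
- exact: (gC (Coef c) (Coef d)).
- exact: (gC (Coef c) (Tau j)).
- exact: xC.
- exact: (gC (Tau i) (Coef d)).
- exact: (gC (Tau i) (Tau j)).
- exact: xC.
- by rewrite xC.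
- by rewrite xC.
- exact: xC.
Qed.

Lemma opx_inv g i : Ainv (opx g i) = sg (Aodd g) (opx g i).
Proof.
case: g => [c|k|k] /=; rewrite /coef /taub ?Ainv_gen ?sgE //.
by case: i => [|i]; rewrite /= ?rmorph1 // Ainv_gen sgE.
Qed.

Lemma opLC g h t : opL g (opL h t) = sg (Aodd g && Aodd h) (opL h (opL g t)).
Proof.
rewrite [opL h t]/opL (zm_sum (opLB g)) [opL h (opL g t)]/opL -sg_sum.
apply: eq_bigr => i _; have yB := lmulB (opx h i) (@central_opy h i).
rewrite /opL (zm_sum yB) -sg_sum; apply: eq_bigr => j _.
by apply: lmulC; [apply: central_opy.. | apply: opxC].
Qed.

Lemma opSL g h t : opS g (opL h t) = sg (Aodd g && Aodd h) (opL h (opS g t)).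
Proof.
case: g => [c|k|k] /=; rewrite ?(zm0 (opLB h)) ?(zm0 (@sgB _ _)) //.
rewrite /opL (zm_sum (lmul_tauB k)) -sg_sum; apply: eq_bigr => i _.
by apply: lmul_tauC; [apply: central_opy | apply: opx_inv].
Qed.

Lemma opSS g h t : opS g (opS h t) = sg (Aodd g && Aodd h) (opS h (opS g t)).
Proof.
case: g h => [c|k|k] [d|l|l] /=; rewrite ?(zm0 (lmul_tauB _)) ?(zm0 (@sgB _ _)) //.
exact: lmul_tau2.
Qed.

Lemma coprod_opC g h t :
  coprod_op g (coprod_op h t) =
  sg (Aodd g && Aodd h) (coprod_op h (coprod_op g t)).
Proof.
rewrite !coprod_opE !(zmD (opSB _)) !(zmD (opLB _)) !sgD.
rewrite opSS opLC opSL [in RHS]opSL [Aodd h && _]andbC sgK.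
by rewrite -!addrA; congr (_ + _); rewrite addrCA.
Qed.

Lemma lmul_sq n (x y : nat -> Ap) t : (forall i, central (y i)) ->
  (forall i j, x i * x j = - (x j * x i)) ->
  \sum_(i < n) lmul (x i) (y i) (\sum_(j < n) lmul (x j) (y j) t) =
  \sum_(i < n) lmul (x i) (y i) (lmul (x i) (y i) t).
Proof.
move=> Cy xC; elim: n => [|n IH]; first by rewrite !big_ord0.
have nB := lmulB (x n) (Cy n); have sB := @lmul_sumB n x y Cy.
rewrite !big_ord_recr /= (zmD nB) addrA; congr (_ + _).
rewrite -IH -[RHS]addr0 (zmD sB) -addrA; congr (_ + _).
rewrite (zm_sum nB) -big_split big1 //= => i _.
by rewrite [lmul (x n) _ (lmul _ _ _)](@lmulC true) //= subrr.
Qed.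

Lemma lmulM x y x' y' t : central y -> central y' ->
  lmul x y (lmul x' y' t) = lmul (x * x') (y * y') t.
Proof.
move=> Cy Cy'; have Cyy := centralM Cy Cy'.
apply: (tens_ext (compB (lmulB x Cy) (lmulB x' Cy')) (lmulB _ Cyy)) t => e n.
by rewrite !lmul_tens // !mulrA.
Qed.

Lemma coprod_op_tau2 k t :
  coprod_op (Tau k) (coprod_op (Tau k) t) =
  lmul_tau k (lmul_tau k t) +
  \sum_(i < k.+1)
     lmul (taub i * taub i) (xib (k - i) ^+ (p ^ i) * xib (k - i) ^+ (p ^ i)) t.
Proof.
have Cx i : central (xib (k - i) ^+ (p ^ i)) by apply: central_xibX.
rewrite !coprod_opE (zmD (opSB (Tau k))) (zmD (opLB (Tau k))) opSL /=.
rewrite addrA subrK; congr (_ + _).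
rewrite /opL /= (@lmul_sq _ taub (fun i => xib (k - i) ^+ (p ^ i))) //.
  by apply: eq_bigr => i _; rewrite lmulM.
exact: taubC.
Qed.

Lemma taub2_odd i : p <> 2%N -> taub i * taub i = 0.
Proof. by move=> p2; have /= := Aextra_rel (Aextra_tau0 i p2). Qed.

Lemma taub2_even i : p = 2%N ->
  taub i * taub i = coef Theta * xib i.+1 + bockA * taub i.+1.
Proof.
move=> p2; have /= -> := Aextra_rel (Aextra_tau2 i p2).
by rewrite reval_rmap reval_bock.
Qed.

Lemma coef_tens c e n : e @ (coef c * n) = (e * etaR_gen c) @ n.
Proof. by rewrite -etaL_gen -ApZ -tens_bal /= etaR_genE. Qed.

Lemma bockA_tens e n : e @ (bockA * n) = (e * bockA) @ n.
Proof.
rewrite /bockA; case: has_bock; first exact: coef_tens.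
by rewrite mul0r mulr0 tens0r tens0l.
Qed.

Lemma lmul0 y t : central y -> lmul 0 y t = 0.
Proof.
move=> Cy; have zB : zmod_morphism (fun _ : AA => 0 : AA).
  by move=> ? ?; rewrite subr0.
apply: (tens_ext (lmulB 0 Cy) zB) t => e n.
by rewrite lmul_tens // mul0r tens0l.
Qed.

Lemma ract_bock (t : AA) :
  ract coprod_op (rmap Coef bock) t = lmul bockA 1 t.
Proof.
by rewrite /bock /bockA; case: has_bock; rewrite //= lmul0 //; apply: central1.
Qed.

Lemma Ap_natr_tensor (t : AA) : t *+ p = 0.
Proof.
elim/tensor_ind: t => [e n||x IH|x y IHx IHy].
- suff -> m : (e @ n) *+ m = (e *+ m) @ n.
    by rewrite -mulr_natr Ap_char mulr0 tens0l.
  by elim: m => [|m IH]; rewrite ?mulr0n ?tens0l // !mulrS tensDl IH.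
- by rewrite mul0rn.
- by rewrite mulNrn IH oppr0.
- by rewrite mulrnDl IHx IHy addr0.
Qed.

Lemma ract_rnat (V : zmodType) (op : Agen -> V -> V) n t :
  ract op (rnat _ n) t = t *+ n.
Proof. by elim: n => //= n ->; rewrite mulrS. Qed.

Lemma lmulDl x x' y t : central y -> lmul (x + x') y t = lmul x y t + lmul x' y t.
Proof.
move=> Cy; apply: (tens_ext (lmulB _ Cy) (addB (lmulB x Cy) (lmulB x' Cy))) t.
by move=> e n; rewrite !lmul_tens // mulrDl tensDl.
Qed.

Lemma lmul_tau2_even k t : p = 2%N ->
  lmul_tau k (lmul_tau k t) =
  lmul (coef Theta) (xib k.+1) t + lmul (bockA * taub 0) (xib k.+1) t +
  lmul bockA 1 (lmul_tau k.+1 t).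
Proof.
move=> p2; have C := central_p2 p2; have kB := lmul_tauB k.
have Cx := central_xib k.+1.
apply: (tens_ext (compB kB kB) (addB (addB (lmulB _ Cx) (lmulB _ Cx))
                    (compB (lmulB _ central1) (lmul_tauB _)))) t => e n.
rewrite !lmul_tau_tens !lmul_tens //.
rewrite AinvK (Ainv_p2 p2) mulrA taub2_even // mulrDl tensDr -!mulrA mul1r.
rewrite coef_tens bockA_tens /= mulrDr tensDl !mulrA.
by rewrite [coef Theta * e]C [bockA * taub 0 * e]C [bockA * e]C mulrA.
Qed.

Lemma coprod_sat_tau2 k t : p = 2%N ->
  coprod_op (Tau k) (coprod_op (Tau k) t) =
  coprod_op (Coef Theta) (coprod_op (Xi k) t) +
  lmul bockA 1 (coprod_op (Tau k.+1) t).
Proof.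
move=> p2; have C1 := central1.
have Cx j i : central (xib j ^+ (p ^ i)) by apply: central_xibX.
have xx (i : nat) : xib (k - i) ^+ (p ^ i) * xib (k - i) ^+ (p ^ i) =
    xib (k.+1 - i.+1) ^+ (p ^ i.+1).
  by rewrite -exprD subSS expnS p2 mul2n addnn.
rewrite coprod_op_tau2 lmul_tau2_even // /coprod_op.
rewrite (zmD (lmulB bockA C1)) !(zm_sum (lmulB _ C1)).
under eq_bigr => i _.
  rewrite xx taub2_even // lmulDl //; over.
rewrite big_split /=.
under [X in _ = X + _]eq_bigr => i _ do rewrite lmulM // mul1r.
under [X in _ = _ + (_ + X)]eq_bigr => i _ do rewrite lmulM // mul1r.
have R (f : nat -> AA) :
    \sum_(i < k.+2) f i = f 0%N + \sum_(i < k.+1) f i.+1.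
  by rewrite big_ord_recl.
rewrite (R (fun i => lmul (coef Theta * xib i) (xib (k.+1 - i) ^+ (p ^ i)) t)).
rewrite (R (fun i => lmul (bockA * taub i) (xib (k.+1 - i) ^+ (p ^ i)) t)).
cbv beta; rewrite subn0 expn0 expr1 [coef Theta * xib 0]mulr1.
rewrite -!addrA; congr (_ + _).
by rewrite [LHS]addrCA [RHS]addrCA; congr (_ + _); apply: addrCA.
Qed.

Lemma coprod_sat s t : Arel s t -> ract coprod_op s =1 ract coprod_op t.
Proof.
case=> {s t} [|g h|s t [s' t' [h|h]|i p2|i p2]] x.
- by rewrite /= ract_rnat Ap_natr_tensor.
- have := coprod_opC g h x; rewrite /rsign /=.
  by case: (Aodd g); case: (Aodd h).
- by rewrite /= coef_gam // lmul0 //; apply: central1.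
- by rewrite /= lmulM ?coef_gam2 ?lmul0 ?mulr1 //; apply: central1.
- rewrite -[LHS]/(coprod_op (Tau i) (coprod_op (Tau i) x)) coprod_sat_tau2 //.
  by rewrite -ract_bock.
- rewrite -[LHS]/(coprod_op (Tau i) (coprod_op (Tau i) x)) -[RHS]/(0 : AA).
  rewrite coprod_op_tau2 big1 => [|j _]; last first.
    by rewrite taub2_odd // lmul0 //; apply: centralM; apply: central_xibX.
  have zB : zmod_morphism (fun _ : AA => 0 : AA) by move=> ? ?; rewrite subr0.
  have iB := lmul_tauB i; rewrite addr0.
  apply: (tens_ext (compB iB iB) zB) x => e n.
  by rewrite !lmul_tau_tens mulrA taub2_odd // mul0r tens0r.
Qed.

Lemma coprod_cong s t : rcong Arel s t -> ract coprod_op s =1 ract coprod_op t.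
Proof. exact: (ract_cong coprod_opB coprod_sat). Qed.

Lemma coprod_cls s : coprod (cls Arel s) = ract coprod_op s (1 @ 1).
Proof. exact: (coprod_cong (repr_cls Arel s)). Qed.

Lemma coprod1 : coprod 1 = 1 @ 1.
Proof. by rewrite -[1 in LHS](cls1 Arel) coprod_cls. Qed.

Lemma coprod_zmod : zmod_morphism coprod.
Proof.
elim/cls_ind=> s; elim/cls_ind=> t.
by rewrite -(clsN Arel t) -(clsD Arel s) !coprod_cls.
Qed.

Lemma coprodM g x : coprod (gen Arel g * x) = coprod_op g (coprod x).
Proof. by elim/cls_ind: x => s; rewrite -(clsM Arel (RGen g)) !coprod_cls. Qed.

Definition deg (g : Agen) : int * int :=
  match g with
  | Coef Theta => (0, - twist%:Z)
  | Coef Gam => (-1, - twist%:Z)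
  | Tau i => (2 * (p ^ i)%:Z - 1, (p ^ i)%:Z - 1)
  | Xi i => (2 * (p ^ i.+1)%:Z - 2, (p ^ i.+1)%:Z - 1)
  end.

Definition wt (g : Agen) : nat :=
  match g with Coef _ => 0 | Tau i => p ^ i | Xi i => p ^ i.+1 end.

Definition monom (w : seq Agen) : Ap := \prod_(g <- w) gen Arel g.
Definition monom_deg (w : seq Agen) : int * int := \sum_(g <- w) deg g.
Definition monom_wt (w : seq Agen) : nat := (\sum_(g <- w) wt g)%N.

Definition homogA (d : int * int) (x : Ap) : Prop :=
  exists s : seq (seq Agen),
    all (fun w => monom_deg w == d) s /\ x = \sum_(w <- s) monom w.

Definition coactE (n : int) (x : Ap) : tensor (etaRE n) Ap :=
  tmap etaRm (etaRE n) (projE n) id (coprod x).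

Definition Acomod (n : int) : comodule (etaRE n) :=
  @Comodule _ _ (etaRE n) Ap homogA (@coactE n).

(* (A//E(n))^\vee: the M_p-subalgebra generated by the \bar\xi_i, i >= 1, and
   the \bar\tau_j, j > n. *)
Inductive quotE (n : int) : Ap -> Prop :=
| quotE_coef m : quotE n (etaL m)
| quotE_xi i : quotE n (xib i.+1)
| quotE_tau (j : nat) : n < j%:Z -> quotE n (taub j)
| quotE_add x y : quotE n x -> quotE n y -> quotE n (x + y)
| quotE_mul x y : quotE n x -> quotE n y -> quotE n (x * y).

Lemma quotE0 n : quotE n 0.
Proof. by rewrite -(rmorph0 etaL); apply: quotE_coef. Qed.
Lemma quotE1 n : quotE n 1.
Proof. by rewrite -(rmorph1 etaL); apply: quotE_coef. Qed.
Lemma quotEL n (a : Mp) u v : quotE n u -> quotE n v -> quotE n (a *: u + v).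
Proof.
by move=> Su Sv; apply: quotE_add => //; apply: quotE_mul => //; constructor.
Qed.

Definition AquotE (n : int) : submodule Ap :=
  Submodule (quotE0 n) (@quotEL n).

(* The Brown-Gitler comodule B_n(k): the M_p-span of the monomials of weight at
   most k in the generators of (A//E(n))^\vee. *)
Definition quot_gen (n : int) (g : Agen) : bool :=
  match g with Coef _ => false | Tau j => n < j%:Z | Xi _ => true end.

Definition BG_monom (n : int) (k : nat) (w : seq Agen) : bool :=
  all (quot_gen n) w && (monom_wt w <= k)%N.

Definition BG_pred (n : int) (k : nat) (x : Ap) : Prop :=
  exists s : seq (Mp * seq Agen),
    all (fun c => BG_monom n k c.2) s /\ x = \sum_(c <- s) c.1 *: monom c.2.

Lemma BG_pred0 n k : BG_pred n k 0.
Proof. by exists [::]; rewrite big_nil. Qed.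
Lemma BG_predL n k (a : Mp) u v :
  BG_pred n k u -> BG_pred n k v -> BG_pred n k (a *: u + v).
Proof.
move=> [s [ss ->]] [t [tt ->]].
exists ([seq (a * c.1, c.2) | c <- s] ++ t); split.
  by rewrite all_cat tt andbT all_map.
rewrite big_cat big_map scaler_sumr; congr (_ + _).
by apply: eq_bigr => c _; rewrite scalerA.
Qed.

Definition BG_sub (n : int) (k : nat) : submodule Ap :=
  Submodule (BG_pred0 n k) (@BG_predL n k).

(* spanned S is the image of A \otimes S in A \otimes A; (A//E(n))^\vee and
   B_n(k) are left A_p^\vee-subcomodules of A_p^\vee, a fortiori
   E(m)^\vee-subcomodules for every m. *)
Inductive spanned (S : Ap -> Prop) : AA -> Prop :=
| spanned0 : spanned S 0
| spannedD t u : spanned S t -> spanned S u -> spanned S (t + u)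
| spanned_in e s : S s -> spanned S (e @ s).

Lemma spannedN S t : spanned S t -> spanned S (- t).
Proof.
elim=> {t} [|t u _ IHt _ IHu|e s Ss]; first by rewrite oppr0; constructor.
- by rewrite opprD; constructor.
- by rewrite -tensNl; constructor.
Qed.

Lemma spanned_sum S m (f : 'I_m -> AA) :
  (forall i, spanned S (f i)) -> spanned S (\sum_i f i).
Proof. by move=> Sf; elim/big_rec: _ => [|i t _ St]; constructor. Qed.

Lemma spanned_lmul (S S' : Ap -> Prop) x y t :
  central y -> (forall s, S s -> S' (y * s)) ->
  spanned S t -> spanned S' (lmul x y t).
Proof.
move=> Cy H; have lB := lmulB x Cy; elim=> {t} [|t u _ IHt _ IHu|e s Ss].
- by rewrite (zm0 lB); constructor.
- by rewrite (zmD lB); constructor.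
- by rewrite lmul_tens //; constructor; apply: H.
Qed.

Lemma spanned_lmul_tau (S S' : Ap -> Prop) k t :
  (forall s, S s -> S' (taub k * s)) ->
  spanned S t -> spanned S' (lmul_tau k t).
Proof.
move=> H; have lB := lmul_tauB k; elim=> {t} [|t u _ IHt _ IHu|e s Ss].
- by rewrite (zm0 lB); constructor.
- by rewrite (zmD lB); constructor.
- by rewrite lmul_tau_tens; constructor; apply: H.
Qed.

Lemma spanned_op (S S' : Ap -> Prop) g t :
  (forall i, (i < opn g)%N -> forall s, S s -> S' (opy g i * s)) ->
  (forall k, g = Tau k -> forall s, S s -> S' (taub k * s)) ->
  spanned S t -> spanned S' (coprod_op g t).
Proof.
move=> HL HS St; rewrite coprod_opE; apply: spannedD.
  case: g HL HS => [c|k|k] _ HS; [exact: spanned0| |exact: spanned0].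
  by apply: spanned_lmul_tau St => s; apply: HS.
apply: spanned_sum => i; apply: spanned_lmul St => [|s Ss].
  exact: central_opy.
exact: HL.
Qed.

Lemma spanned_etaL (S : submodule Ap) m x :
  spanned S (coprod x) -> spanned S (coprod (etaL m * x)).
Proof.
have cB := coprod_zmod.
elim/presented_ind: m x => [c x Sx|x _|x Sx|m IH x Sx|m m' IH IH' x Sx|m m' IH IH' x Sx].
- rewrite etaL_gen coprodM; apply: spanned_op Sx => // i _ s.
  by rewrite mul1r.
- by rewrite rmorph0 mul0r (zm0 cB); constructor.
- by rewrite rmorph1 mul1r.
- by rewrite rmorphN mulNr (zmN cB); apply/spannedN/IH.
- by rewrite rmorphD mulrDl (zmD cB); constructor; auto.
- by rewrite rmorphM -mulrA; auto.
Qed.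

Lemma spanned_lift n (S : submodule Ap) x : spanned S (coprod x) ->
  exists u : tensor (etaRE n) (sub_car S),
    tmap (etaRE n) (etaRE n) id (@sub_val _ _ S) u = coactE n x.
Proof.
have B1 : bimap (etaRE n) (etaRE n) id (@sub_val _ _ S).
  by split=> // e m s; rewrite tens_bal.
have B2 : bimap etaRm (etaRE n) (projE n) (id : Ap -> Ap).
  by split=> // [e e'|e m s]; rewrite ?rmorphD // rmorphM -tens_bal.
rewrite /coactE; elim=> {x} [|t u _ [t' Ht] _ [u' Hu]|e s Ss].
- by exists 0; rewrite (tmap0 B1) (tmap0 B2).
- by exists (t' + u'); rewrite (tmapD B1) (tmapD B2) Ht Hu.
- exists (tens _ (projE n e) (sub_in Ss)).
  by rewrite (tmap_tens B1) (tmap_tens B2).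
Qed.

Lemma quotE_xibX n i j : quotE n (xib i ^+ j).
Proof.
elim: j => [|j IH]; first by rewrite expr0; apply: quotE1.
rewrite exprS; apply: quotE_mul => //.
by case: i {IH} => [|i]; [apply: quotE1 | apply: quotE_xi].
Qed.

Lemma spanned_quotE n x y : quotE n x ->
  spanned (quotE n) (coprod y) -> spanned (quotE n) (coprod (x * y)).
Proof.
move=> Ex; elim: Ex y => {x} [m|i|j nj|x x' _ IH _ IH'|x x' _ IH _ IH'] y Sy.
- exact: (@spanned_etaL (AquotE n)).
- rewrite coprodM; apply: spanned_op Sy => // l _ s Ss.
  by apply: quotE_mul => //; apply: quotE_xibX.
- rewrite coprodM; apply: spanned_op Sy => [l _ s Ss|_ [<-] s Ss].
    by apply: quotE_mul => //; apply: quotE_xibX.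
  by apply: quotE_mul => //; apply: quotE_tau.
- by rewrite mulrDl (zmD coprod_zmod); constructor; auto.
- by rewrite -mulrA; auto.
Qed.

Lemma AquotE_coact m n (x : sub_car (AquotE n)) :
  exists t : tensor (etaRE m) (sub_car (AquotE n)),
    tmap (etaRE m) (etaRE m) id (@sub_val _ _ (AquotE n)) t =
    @cm_coact _ _ _ (Acomod m) (sub_val x).
Proof.
apply: spanned_lift; rewrite -[sub_val x]mulr1; apply: spanned_quotE.
  exact: (@sub_car_pred _ _ (AquotE n) x).
by rewrite coprod1; constructor; apply: quotE1.
Qed.

Lemma BG_pred_monom n k w : BG_monom n k w -> BG_pred n k (monom w).
Proof.
by move=> kw; exists [:: (1, w)]; rewrite /= kw big_seq1 scale1r.
Qed.

(* Left multiplication by a monomial v, moved past the scalars. *)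
Lemma BG_pred_mul n k l v (f : Mp -> Mp) s :
  (forall m x, monom v * (m *: x) = f m *: (monom v * x)) ->
  BG_monom n l v -> BG_pred n k s -> BG_pred n (l + k) (monom v * s).
Proof.
move=> vf /andP[vn vl] [c [cP ->]].
exists [seq (f a.1, v ++ a.2) | a <- c]; split.
  rewrite all_map; apply: sub_all cP => a /= /andP[an ak].
  by rewrite /BG_monom all_cat vn an /monom_wt big_cat leq_add.
rewrite big_map mulr_sumr; apply: eq_bigr => a _.
by rewrite vf /monom big_cat.
Qed.

Lemma BG_pred_xibX n k i j s :
  BG_pred n k s -> BG_pred n (j * p ^ i + k) (xib i ^+ j * s).
Proof.
case: i => [|i] Bs.
  rewrite /= expr1n mul1r; case: Bs => c [cP ->]; exists c; split=> //.
  apply: sub_all cP => a /andP[an ak]; rewrite /BG_monom an /=.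
  exact: leq_trans ak (leq_addl _ _).
have -> : xib i.+1 ^+ j = monom (nseq j (Xi i)).
  by rewrite /monom big_nseq iter_mulr_1.
apply: (@BG_pred_mul n k _ _ id) Bs => [m x|].
  rewrite !ApZ /monom big_nseq iter_mulr_1 mulrA.
  by rewrite [_ ^+ j * _](@central_xibX i.+1 j) mulrA.
by rewrite /BG_monom all_nseq /= orbT /monom_wt big_nseq iter_addn_0 mulnC /=.
Qed.

Lemma BG_pred_le n k l s : (k <= l)%N -> BG_pred n k s -> BG_pred n l s.
Proof.
move=> kl [c [cP ->]]; exists c; split=> //; apply: sub_all cP => a.
by case/andP=> an ak; rewrite /BG_monom an (leq_trans ak).
Qed.

Lemma BG_pred_opy n k g i s : (i < opn g)%N ->
  BG_pred n k s -> BG_pred n (wt g + k) (opy g i * s).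
Proof.
have le (a b : nat) : (a <= b -> p ^ a * p ^ (b - a) <= p ^ b)%N.
  by move=> ab; rewrite -expnD subnKC.
case: g => [c|l|l] /=; first by rewrite mul1r.
- rewrite ltnS => il /(BG_pred_xibX (l - i) (p ^ i)).
  by apply: BG_pred_le; rewrite leq_add2r le.
- rewrite ltnS => il /(BG_pred_xibX (l.+1 - i) (p ^ i)).
  by apply: BG_pred_le; rewrite leq_add2r le.
Qed.

Lemma BG_pred_taub n k l s : n < l%:Z ->
  BG_pred n k s -> BG_pred n (p ^ l + k) (taub l * s).
Proof.
have -> : taub l = monom [:: Tau l] by rewrite /monom big_seq1.
move=> nl; apply: (@BG_pred_mul _ _ _ _ Minv) => [m x|].
  rewrite !ApZ /monom big_seq1 mulrA -/(taub l) taub_swap Ainv_etaL.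
  by rewrite mulrA.
by rewrite /BG_monom /= nl /monom_wt big_seq1 leqnn.
Qed.

Lemma spanned_monom n w : all (quot_gen n) w ->
  spanned (BG_pred n (monom_wt w)) (coprod (monom w)).
Proof.
rewrite /monom /monom_wt; elim: w => [|g w IH] /=.
  rewrite !big_nil coprod1 => _; constructor.
  by have := @BG_pred_monom n 0 [::]; rewrite /BG_monom /monom /monom_wt !big_nil; apply.
case/andP=> ng /IH Sw; rewrite !big_cons coprodM.
apply: spanned_op Sw => [i ig s|l gl s]; first exact: BG_pred_opy.
by rewrite gl in ng *; apply: BG_pred_taub.
Qed.

Lemma spannedW (S S' : Ap -> Prop) t :
  (forall s, S s -> S' s) -> spanned S t -> spanned S' t.
Proof. by move=> H; elim=> {t} *; constructor; auto. Qed.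

Lemma BG_coact m n k (x : sub_car (BG_sub n k)) :
  exists t : tensor (etaRE m) (sub_car (BG_sub n k)),
    tmap (etaRE m) (etaRE m) id (@sub_val _ _ (BG_sub n k)) t =
    @cm_coact _ _ _ (Acomod m) (sub_val x).
Proof.
apply: spanned_lift; have /= [c [cP ->]] := @sub_car_pred _ _ (BG_sub n k) x.
elim: c cP => [|a c IH] /=.
  by rewrite big_nil (zm0 coprod_zmod); constructor.
case/andP=> /andP[an ak] /IH Sc.
rewrite big_cons (zmD coprod_zmod); constructor=> //; rewrite ApZ.
apply: (@spanned_etaL (BG_sub n k)); apply: spannedW (spanned_monom an) => s.
exact: BG_pred_le.
Qed.

(* H_{*,*} BPGL<n>, identified with (A//E(n))^\vee, as an
   E(n)^\vee-comodule. *)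
Definition H_BPGL (n : int) : comodule (etaRE n) :=
  @subcomodule _ _ _ (Acomod n) (AquotE n) (@AquotE_coact n n).

(* B_n(k) as an E(m)^\vee-comodule. *)
Definition BrownGitler (m n : int) (k : nat) : comodule (etaRE m) :=
  @subcomodule _ _ _ (Acomod m) (BG_sub n k) (@BG_coact m n k).
End DualSteenrod.

(* Main.v *)
(* The weight is a grading of A^\vee, and (A//E(n))^\vee lives in weights divisible
   by p.  Lowering all indices by one, \bar\xi_{i+1} |-> \bar\xi_i (so that
   \bar\xi_1 |-> 1) and \bar\tau_{j+1} |-> \bar\tau_j, carries the part of weight
   p k isomorphically onto B_{n-1}(k): the inverse raises the indices and restores
   the weight with a power of \bar\xi_1.  Lowering
   shifts degrees by (-2 k (p - 1), -k (p - 1)), and it commutes with the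
   E(n)^\vee-coaction since the \bar\xi_i vanish in E(n)^\vee.

   (A//E(n))^\vee is only given as a subring of a presented ring, on which the
   lowering map cannot be defined directly.  It is obtained by restricting an
   additive map on all of A^\vee, a matrix coefficient of a representation of
   A^\vee in which \bar\tau_0, whose index cannot be lowered, acts by a 2 x 2
   matrix.  This avoids any monomial basis theorem.

   The coactions on subcomodules are lifts along E \otimes S -> E \otimes A^\vee;
   they are unique for S = B_{n-1}(k), as this is an M_p-linear retract of A^\vee. *)
Require Import Defs.
From mathcomp Require Import all_boot all_order all_algebra.
From mathcomp Require Import boolp.
From HB Require Import structures.
From mathcomp Require Import zify ring finfield.

Set Implicit Arguments.
Unset Strict Implicit.
Unset Printing Implicit Defensive.

Import GRing.Theory.
Local Open Scope ring_scope.

(** * Square roots of scalars, tensor products and direct sums *)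

(** Up to transposition, the companion matrix of $X^2-a$. *)
Definition sqrt_mx (R : pzRingType) (a : R) : 'M[R]_2 :=
  \matrix_(i, j) if i == 0 then if j == 0 then 0 else a else (j == 0)%:R.

Lemma sqrt_mxE (R : pzRingType) (a : R) : sqrt_mx a *m sqrt_mx a = a%:M.
Proof.
apply/matrixP => i j; rewrite !mxE !big_ord_recr big_ord0 /= !mxE /=.
case: i j => [[|[|i]] hi] [[|[|j]] hj] //=;
  by rewrite ?mulr0 ?mul0r ?mulr1 ?mul1r ?addr0 ?add0r.
Qed.

Lemma reval_rmorph (R R' : pzRingType) (f : {rmorphism R -> R'}) G (v : G -> R) s :
  f (reval v s) = reval (f \o v) s.
Proof.
elim: s => //= [||s IH|s IHs t IHt|s IHs t IHt].
- by rewrite rmorph0.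
- by rewrite rmorph1.
- by rewrite rmorphN IH.
- by rewrite rmorphD IHs IHt.
- by rewrite rmorphM IHs IHt.
Qed.

Lemma tensor_ext (M R : pzRingType) (eta : {rmorphism M -> R}) (N : lmodType M)
    (V : zmodType) (f g : tensor eta N -> V) :
  zmod_morphism f -> zmod_morphism g ->
  (forall e x, f (tens eta e x) = g (tens eta e x)) -> f =1 g.
Proof.
move=> fB gB fg; elim/tensor_ind=> // [|x IH|x y IHx IHy].
- by rewrite (zm0 fB) (zm0 gB).
- by rewrite (zmN fB) (zmN gB) IH.
- by rewrite (zmD fB) (zmD gB) IHx IHy.
Qed.

Lemma bimap_id (M R : pzRingType) (eta : {rmorphism M -> R}) (N N' : lmodType M)
    (g : N -> N') :
  (forall x y, g (x + y) = g x + g y) -> (forall a x, g (a *: x) = a *: g x) ->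
  bimap eta eta id g.
Proof. by move=> gD gZ; split=> // e m x; rewrite tens_bal gZ. Qed.

Lemma tmap_comp (M R : pzRingType) (eta : {rmorphism M -> R})
    (N N' N'' : lmodType M) (g : N -> N') (h : N' -> N'') :
  bimap eta eta id g -> bimap eta eta id h -> bimap eta eta id (h \o g) ->
  forall t, tmap eta eta id h (tmap eta eta id g t) = tmap eta eta id (h \o g) t.
Proof.
move=> Bg Bh Bhg; have gB := tmap_zmod Bg; have hB := tmap_zmod Bh.
apply: (tensor_ext (compB hB gB) (tmap_zmod Bhg)) => e x.
by rewrite (tmap_tens Bg) (tmap_tens Bh) (tmap_tens Bhg).
Qed.

Section DirectSumTheory.
Variables (M : pzRingType) (V : nat -> lmodType M).
Implicit Types (f g : dsum V) (k j : nat).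

Lemma dsum_inj_in k (x : V k) : dsum_inj x k = x.
Proof. exact: dfwith_in. Qed.

Lemma dsum_inj_out k j (x : V k) : k != j -> dsum_inj x j = 0.
Proof. exact: dfwith_out. Qed.

Lemma dsum_addE f g j : (f + g) j = f j + g j.
Proof. by []. Qed.

Lemma dsum_scaleE a f j : (a *: f) j = a *: f j.
Proof. by []. Qed.

Lemma dsum_injD k (x y : V k) : dsum_inj (x + y) = dsum_inj x + dsum_inj y.
Proof.
apply: dsumP => j; rewrite dsum_addE.
have [<-|kj] := eqVneq k j; first by rewrite !dsum_inj_in.
by rewrite !dsum_inj_out // addr0.
Qed.

Lemma dsum_injZ k a (x : V k) : dsum_inj (a *: x) = a *: dsum_inj x.
Proof.
apply: dsumP => j; rewrite dsum_scaleE.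
have [<-|kj] := eqVneq k j; first by rewrite !dsum_inj_in.
by rewrite !dsum_inj_out // scaler0.
Qed.

Lemma dsum_sumE N (g : nat -> dsum V) j : (\sum_(k < N) g k) j = \sum_(k < N) g k j.
Proof. exact: (big_morph (fun f : dsum V => f j)). Qed.

Lemma dsum_decomp f N : (forall k, (N <= k)%N -> f k = 0) ->
  f = \sum_(k < N) dsum_inj (f k).
Proof.
move=> fN; apply: dsumP => j; rewrite (dsum_sumE _ (fun k => dsum_inj (f k))).
have [Nj|jN] := leqP N j.
  by rewrite fN // big1 // => k _; rewrite dsum_inj_out // ltn_eqF // (leq_trans _ Nj).
rewrite (bigD1 (Ordinal jN)) //= big1 => [|k kj].
  by rewrite addr0 [RHS](dsum_inj_in (f j)).
exact: dsum_inj_out.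
Qed.
End DirectSumTheory.

Lemma tens_sumr (M R : pzRingType) (eta : {rmorphism M -> R}) (N : lmodType M)
    e m (f : 'I_m -> N) :
  tens eta e (\sum_k f k) = \sum_k tens eta e (f k).
Proof.
by apply: (big_morph (tens eta e)); [apply: tensDr | apply: tens0r].
Qed.

Lemma sub_valD (M : pzRingType) (V : lmodType M) (S : submodule V)
  (x y : sub_car S) : sub_val (x + y) = sub_val x + sub_val y.
Proof. by []. Qed.

Lemma sub_valZ (M : pzRingType) (V : lmodType M) (S : submodule V)
  a (x : sub_car S) : sub_val (a *: x) = a *: sub_val x.
Proof. by []. Qed.

Lemma sub_val_inj (M : pzRingType) (V : lmodType M) (S : submodule V)
  (x y : sub_car S) : sub_val x = sub_val y -> x = y.
Proof. exact: val_inj. Qed.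

(** * Weights and index shifts *)

Section Main.
Variables (p : nat) (F : base).
Hypothesis p_prime : prime p.

Local Notation Mp := (Mp p F).
Local Notation Ap := (Ap p F).
Local Notation gen g := (gen (Arel p F) g : Ap).
Local Notation etaL := (@etaL p F).
Local Notation xib := (@xib p F).
Local Notation taub := (@taub p F).
Local Notation bockA := (@bockA p F).
Local Notation coef := (@coef p F).

Lemma Ap_sat (R : pzRingType) (v : Agen -> R) :
  p%:R = 0 :> R ->
  (forall g h, v g * v h = (-1) ^+ (Aodd g && Aodd h) * (v h * v g)) ->
  (forall s t, Aextra p F s t -> reval v s = reval v t) ->
  forall s t, Arel p F s t -> reval v s = reval v t.
Proof. exact: sat_gcrel. Qed.

(** All relations hold in ['F_p] once the generators are sent to 0, so [1] survives there.
    Nontriviality of [Ap] gives access to polynomials over it. *)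
Lemma Ap_neq0 : (1 : Ap) != 0.
Proof.
have sat : forall s t, Arel p F s t ->
    reval (fun=> 0 : 'F_p) s = reval (fun=> 0 : 'F_p) t.
  apply: Ap_sat => [|g h|s t [u v [_|_]|i _|i _]]; rewrite /= ?mulr0 ?mul0r //.
    exact: pchar_Fp_0.
  by rewrite addr0.
apply/eqP => /(congr1 (rlift (fun=> 0 : 'F_p))).
rewrite (rlift_monoid sat).1 (zm0 (rlift_zmod sat)).
by move/eqP; rewrite oner_eq0.
Qed.

HB.instance Definition _ := GRing.PzSemiRing_isNonZero.Build Ap Ap_neq0.

(** The exponent of X records a weight. *)
Definition mX (a : Ap) (n : nat) : {poly Ap} := a%:P * 'X^n.

Lemma mXM a b m n : mX a m * mX b n = mX (a * b) (m + n).
Proof.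
by rewrite /mX polyCM exprD -!mulrA; congr (_ * _); rewrite !mulrA (commr_polyXn b%:P m).
Qed.

Lemma mXD a b n : mX a n + mX b n = mX (a + b) n.
Proof. by rewrite /mX polyCD mulrDl. Qed.

Lemma mX0 n : mX 0 n = 0.
Proof. by rewrite /mX polyC0 mul0r. Qed.

Lemma mXN a n : - mX a n = mX (- a) n.
Proof. by rewrite /mX polyCN mulNr. Qed.

Lemma mX_sign (b : bool) a n : (-1) ^+ b * mX a n = mX ((-1) ^+ b * a) n.
Proof. by case: b; rewrite /= ?expr0 ?mul1r // expr1 !mulN1r mXN. Qed.

Lemma coef_mXM a n (P : {poly Ap}) k :
  (mX a n * P)`_k = if (k < n)%N then 0 else a * P`_(k - n).
Proof. by rewrite /mX -mulrA coefCM coefXnM; case: ltnP; rewrite ?mulr0. Qed.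

Lemma coef_mX a n k : (mX a n)`_k = if k == n then a else 0.
Proof. by rewrite /mX coefCM coefXn; case: eqP; rewrite ?mulr1 ?mulr0. Qed.

Definition gsh (e : nat) (g : Agen) : Agen :=
  match g with Coef c => Coef c | Tau i => Tau (e + i) | Xi i => Xi (e + i) end.

Lemma Aodd_gsh e g : Aodd (gsh e g) = Aodd g.
Proof. by case: g. Qed.

(* For e = 0 the coefficients of the induced ring morphism are the weight
   components; for e = 1 they are these components with all indices raised. *)
Definition wshift_gen e g : {poly Ap} := mX (gen (gsh e g)) (wt p g).

Lemma reval_bockA (R : pzRingType) (f : Ap -> R) (v : Agen -> R) :
  f 0 = 0 -> v (Coef Gam) = f (coef Gam) ->
  reval v (rmap Coef (bock p F)) = f bockA.
Proof.
by move=> f0 vG; rewrite reval_rmap reval_bock /= vG /Defs.bockA; case: has_bock.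
Qed.

Lemma poly_char : p%:R = 0 :> {poly Ap}.
Proof. by rewrite -polyC_natr Ap_char polyC0. Qed.

Lemma expnD2 i : p = 2%N -> (p ^ i + p ^ i = p ^ i.+1)%N.
Proof. by move=> p2; rewrite expnS p2 mul2n addnn. Qed.

(** The relations are homogeneous for the weight and keep their form when indices are raised; at
    $p=2$, $\bar\tau_i^2$ has weight $2\cdot 2^i=2^{i+1}$, the weight of $\bar\xi_{i+1}$ and of
    $\bar\tau_{i+1}$. *)
Lemma wshift_sat e s t : Arel p F s t -> reval (wshift_gen e) s = reval (wshift_gen e) t.
Proof.
apply: Ap_sat => [|g h|{}s {}t]; first exact: poly_char.
  rewrite /wshift_gen !mXM mX_sign addnC; congr mX.
  by have := gc_commE Aodd p (Aextra p F) (gsh e g) (gsh e h); rewrite !Aodd_gsh.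
case=> {s t} [_ _ [h|h]|i p2|i p2] /=.
- by rewrite /wshift_gen /= -/(coef Gam) coef_gam // mX0.
- by rewrite /wshift_gen /= mXM -/(coef Gam) coef_gam2 // mX0.
- rewrite (@reval_bockA _ (mX^~ 0%N)) ?mX0 // /wshift_gen !mXM /= !add0n.
  rewrite (expnD2 i p2) mXD addnS; congr mX.
  exact: taub2_even.
- by rewrite /wshift_gen !mXM [X in mX X _]taub2_odd // mX0.
Qed.

Definition wshift e : Ap -> {poly Ap} := rlift (wshift_gen e).
HB.instance Definition _ e := GRing.isZmodMorphism.Build Ap {poly Ap} (wshift e)
  (rlift_zmod (@wshift_sat e)).
HB.instance Definition _ e := GRing.isMonoidMorphism.Build Ap {poly Ap} (wshift e)
  (rlift_monoid (@wshift_sat e)).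

Lemma wshift_genE e g : wshift e (gen g) = mX (gen (gsh e g)) (wt p g).
Proof. exact: (rlift_gen (@wshift_sat e)). Qed.

Lemma wshift_etaL e m : wshift e (etaL m) = (etaL m)%:P.
Proof.
elim/presented_ind: m => [c|||x IH|x y IH IH'|x y IH IH'].
- by rewrite etaL_gen wshift_genE /mX expr0 mulr1.
- by rewrite !rmorph0.
- by rewrite !rmorph1.
- by rewrite !rmorphN /= IH.
- by rewrite !rmorphD /= IH IH'.
- by rewrite !rmorphM /= IH IH'.
Qed.

(* dgen g is g with its index lowered, of weight dwt g; the value at Tau 0 is
   junk. *)
Definition opi (g : Agen) : nat :=
  match g with Coef _ => 0 | Tau i => i.-1 | Xi i => i end.
Definition dgen (g : Agen) : Ap := opx p F g (opi g).
Definition dwt (g : Agen) : nat :=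
  match g with Coef _ => 0 | Tau i => p ^ i.-1 | Xi i => p ^ i end.
(* At p = 2 the relation for \bar\tau_0^2 asks for a square root of
   \Theta + bock \bar\tau_0, which exists among the 2 x 2 matrices. *)
Definition Tau0_mx : 'M[{poly Ap}]_2 :=
  if p == 2%N then sqrt_mx (mX (coef Theta + bockA * taub 0) 1) else 0.

Definition unshift_gen_mx (g : Agen) : 'M[{poly Ap}]_2 :=
  if g == Tau 0 then Tau0_mx else (mX (dgen g) (dwt g))%:M.

Lemma poly_comm2 : p = 2%N -> forall P Q : {poly Ap}, P * Q = Q * P.
Proof.
move=> p2 P Q; apply/polyP => k; rewrite coefM coefMr.
by apply: eq_bigr => i _; apply: central_p2.
Qed.

Lemma scalar_comm (a : {poly Ap}) (A : 'M[{poly Ap}]_2) : p = 2%N ->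
  a%:M * A = A * a%:M.
Proof.
move=> p2; rewrite -[LHS]/(a%:M *m A) mul_scalar_mx; apply/matrixP => i j.
rewrite [RHS]mxE (bigD1 j) //= big1 => [|k /negbTE kj].
  by rewrite !mxE eqxx mulr1n addr0 (poly_comm2 p2).
by rewrite !mxE kj mulr0n mulr0.
Qed.

Definition isTau0 (g : Agen) : bool := if g is Tau 0 then true else false.

Lemma unshift_genE g : ~~ isTau0 g -> unshift_gen_mx g = (mX (dgen g) (dwt g))%:M.
Proof. by case: g => [c|[|i]|i]. Qed.

Lemma Tau0_mx2 : p = 2%N ->
  Tau0_mx * Tau0_mx = (mX (coef Theta + bockA * taub 0) 1)%:M.
Proof. by rewrite /Tau0_mx => /eqP->; exact: sqrt_mxE. Qed.

Lemma Tau0_mx0 : p <> 2%N -> Tau0_mx = 0.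
Proof. by rewrite /Tau0_mx => /eqP/negbTE->. Qed.

Lemma mx_char : p%:R = 0 :> 'M[{poly Ap}]_2.
Proof.
rewrite -[p%:R]/((1%:M : 'M[{poly Ap}]_2) *+ p) -raddfMn -/(p%:R).
by rewrite /= poly_char raddf0.
Qed.

Lemma dgenC g h : dgen g * dgen h = (-1) ^+ (Aodd g && Aodd h) * (dgen h * dgen g).
Proof. by rewrite /dgen opxC sgE. Qed.

Lemma scalarM (a b : {poly Ap}) :
  a%:M * b%:M = (a * b)%:M :> 'M[{poly Ap}]_2.
Proof. by rewrite scalar_mxM. Qed.

(** At $p=2$ signs disappear and scalar matrices are central, so they commute with [Tau0_mx]; at odd
    $p$ that matrix is 0. The relation for $\bar\tau_0^2$ is [Tau0_mx2], and the one for
    $\bar\tau_{i+1}^2$ lowers to the one for $\bar\tau_i^2$. *)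
Lemma unshift_sat s t : Arel p F s t -> reval unshift_gen_mx s = reval unshift_gen_mx t.
Proof.
apply: Ap_sat => [|g h|{}s {}t]; first exact: mx_char.
  have [p2|p2] := eqVneq p 2%N.
    have two0 : 2%:R = 0 :> 'M[{poly Ap}]_2.
      by rewrite -[X in X%:R]p2 mx_char.
    have sgn (b : bool) (A : 'M[{poly Ap}]_2) : (-1) ^+ b * A = A.
      case: b; rewrite /= ?expr0 ?mul1r // expr1 mulN1r.
      apply/eqP; rewrite -subr_eq0 -opprD oppr_eq0 -mulr2n -mulr_natr.
      by rewrite two0 mulr0.
    rewrite sgn; case gT: (isTau0 g); case hT: (isTau0 h).
    - by case: g h gT hT => [|[]|] // [|[]|].
    - by rewrite (@unshift_genE h) ?hT // scalar_comm.
    - by rewrite (@unshift_genE g) ?gT // scalar_comm.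
    - rewrite !unshift_genE ?gT ?hT // !scalarM.
      by rewrite (poly_comm2 p2).
  have T0 := Tau0_mx0 (elimN eqP p2).
  case gT: (isTau0 g); last case hT: (isTau0 h).
  - by case: g gT => [|[]|] //; rewrite /unshift_gen_mx eqxx T0 !(mul0r, mulr0).
  - by case: h hT => [|[]|] //; rewrite /unshift_gen_mx eqxx T0 !(mul0r, mulr0).
  - rewrite !unshift_genE ?gT ?hT // !scalarM.
    rewrite !mXM dgenC addnC -mX_sign.
    by case: (_ && _); rewrite /= ?expr0 ?mul1r // expr1 !mulN1r raddfN.
case=> {s t} [_ _ [h|h]|i p2|i p2].
- by rewrite /= unshift_genE //= /dgen /= coef_gam // mX0 raddf0.
- by rewrite /= unshift_genE //= /dgen /= scalarM mXM coef_gam2 // mX0 raddf0.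
- rewrite [RHS]/= (@reval_bockA _ (fun a => (mX a 0%N)%:M)) ?mX0 ?raddf0 //.
  rewrite !(@unshift_genE (Xi _), @unshift_genE (Tau _.+1), @unshift_genE (Coef _)) //.
  rewrite !scalarM -raddfD !mXM /dgen /= !add0n mXD.
  case: i => [|i] /=.
    by rewrite [LHS](Tau0_mx2 p2) expn0 mulr1.
  rewrite scalarM mXM (taub2_even _ _ p2).
  by rewrite (expnD2 i p2).
- case: i => [|i].
    by rewrite /= [X in X * _](Tau0_mx0 p2) mul0r.
  by rewrite /= /unshift_gen_mx /= scalarM mXM taub2_odd // mX0 raddf0.
Qed.

Definition unshift_mx : Ap -> 'M[{poly Ap}]_2 := rlift unshift_gen_mx.
HB.instance Definition _ := GRing.isZmodMorphism.Build Ap 'M[{poly Ap}]_2 unshift_mx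
  (rlift_zmod unshift_sat).
HB.instance Definition _ := GRing.isMonoidMorphism.Build Ap 'M[{poly Ap}]_2 unshift_mx
  (rlift_monoid unshift_sat).

Lemma unshift_mx_gen g : unshift_mx (gen g) = unshift_gen_mx g.
Proof. exact: (rlift_gen unshift_sat). Qed.

Lemma unshift_mx_etaL m : unshift_mx (etaL m) = (etaL m)%:P%:M.
Proof.
elim/presented_ind: m => [c|||x IH|x y IH IH'|x y IH IH'].
- by rewrite etaL_gen unshift_mx_gen unshift_genE // /mX expr0 mulr1.
- by rewrite !rmorph0.
- by rewrite !rmorph1.
- by rewrite !rmorphN /= IH.
- by rewrite !rmorphD /= IH IH'.
- by rewrite !rmorphM /= IH IH' scalarM -polyCM.
Qed.

(** All generators except $\bar\tau_0$ act by scalar matrices. On the subring they generate, this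
    coefficient is therefore the part of weight $pk$ with its indices lowered. *)
Definition unshift (k : nat) (x : Ap) : Ap := (unshift_mx x 0 0)`_k.

Lemma unshiftB k : zmod_morphism (unshift k).
Proof. by move=> x y; rewrite /unshift raddfB !mxE coefB. Qed.
HB.instance Definition _ k := GRing.isZmodMorphism.Build Ap Ap (unshift k) (unshiftB k).

Lemma unshift_etaL k m x : unshift k (etaL m * x) = etaL m * unshift k x.
Proof.
by rewrite /unshift rmorphM /= unshift_mx_etaL -[_ * _]/(_ *m _) mul_scalar_mx mxE coefCM.
Qed.

Lemma unshift_gen k g x : ~~ isTau0 g ->
  unshift k (gen g * x) = if (k < dwt g)%N then 0 else dgen g * unshift (k - dwt g) x.
Proof.
move=> gT; rewrite /unshift rmorphM /= unshift_mx_gen unshift_genE // -[_ * _]/(_ *m _).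
by rewrite mul_scalar_mx mxE coef_mXM.
Qed.

Lemma unshift1 k : unshift k 1 = if k == 0%N then 1 else 0.
Proof. by rewrite /unshift rmorph1 mxE mulr1n coef1; case: eqP. Qed.

Lemma unshift_large x : exists N, forall k, (N <= k)%N -> unshift k x = 0.
Proof. by exists (size (unshift_mx x 0 0)) => k; apply: nth_default. Qed.

Definition alg_gen (n : int) (g : Agen) : bool :=
  if g is Coef _ then true else quot_gen n g.

(** Letting x act on an arbitrary y with [P y], starting from [y = 1], reduces general products to
    left multiplication by one generator, the form in which lowering and the coproduct are
    computed. *)
Lemma quotE_rec (n : int) (P : Ap -> Prop) :
  P 0 -> P 1 -> (forall x, P x -> P (- x)) ->
  (forall x y, P x -> P y -> P (x + y)) ->
  (forall g x, alg_gen n g -> P x -> P (gen g * x)) ->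
  forall x, @quotE p F n x -> P x.
Proof.
move=> P0 P1 PN PD Pg x Ex; rewrite -[x]mulr1.
elim: Ex 1 P1 => {x} [m|i|j nj|x x' _ IH _ IH'|x x' _ IH _ IH'] y Py.
- elim/presented_ind: m y Py => [c|||m IH|m m' IH IH'|m m' IH IH'] y Py.
  + by rewrite etaL_gen; apply: Pg.
  + by rewrite rmorph0 mul0r.
  + by rewrite rmorph1 mul1r.
  + by rewrite rmorphN mulNr; apply/PN/IH.
  + by rewrite rmorphD mulrDl; apply: PD; auto.
  + by rewrite rmorphM -mulrA; auto.
- exact: Pg.
- exact: Pg.
- by rewrite mulrDl; apply: PD; auto.
- by rewrite -mulrA; auto.
Qed.

Lemma wshift_genM e g x k : (wshift e (gen g * x))`_k =
  if (k < wt p g)%N then 0 else gen (gsh e g) * (wshift e x)`_(k - wt p g).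
Proof. by rewrite rmorphM /= wshift_genE coef_mXM. Qed.

Local Notation monom w := (monom p F w).

Lemma monom_cons g w : monom (g :: w) = gen g * monom w.
Proof. by rewrite /Defs.monom big_cons. Qed.

Lemma monom_wt_cons g w : monom_wt p (g :: w) = (wt p g + monom_wt p w)%N.
Proof. by rewrite /monom_wt big_cons. Qed.

Lemma wshift_monom e w :
  wshift e (monom w) = mX (monom (map (gsh e) w)) (monom_wt p w).
Proof.
elim: w => [|g w IH] /=.
  by rewrite /Defs.monom /monom_wt !big_nil rmorph1 /mX polyC1 mulr1.
by rewrite !monom_cons rmorphM /= IH wshift_genE mXM monom_wt_cons.
Qed.

Lemma dgen_gsh g : dgen (gsh 1 g) = gen g. Proof. by case: g. Qed.
Lemma dwt_gsh g : dwt (gsh 1 g) = wt p g. Proof. by case: g. Qed.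

Lemma unshift_gsh k g x : unshift k (gen (gsh 1 g) * x) =
  if (k < wt p g)%N then 0 else gen g * unshift (k - wt p g) x.
Proof. by rewrite unshift_gen ?dgen_gsh ?dwt_gsh //; case: g. Qed.

Lemma unshift_monom w k : unshift k (monom (map (gsh 1) w)) =
  if k == monom_wt p w then monom w else 0.
Proof.
elim: w k => [|g w IH] k /=.
  by rewrite /Defs.monom /monom_wt !big_nil unshift1.
rewrite !monom_cons unshift_gsh IH monom_wt_cons.
case: ltnP => kg; first by rewrite ltn_eqF // (leq_trans kg) ?leq_addr.
rewrite -(eqn_add2l (wt p g)) subnKC //.
by case: eqP; rewrite ?mulr0.
Qed.

(** * Raising indices *)

Local Notation xi1 := (gen (Xi 0)).

Lemma xi1_central a : central (xi1 ^+ a).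
Proof. exact: (@central_xibX p F 1). Qed.

(** Lowering turns $\bar\xi_1$ into 1, but still counts it with lowered weight 1. *)
Lemma unshift_xi1X k a x : unshift k (xi1 ^+ a * x) =
  if (k < a)%N then 0 else unshift (k - a) x.
Proof.
elim: a k => [|a IH] k; first by rewrite expr0 mul1r subn0.
rewrite exprS -mulrA unshift_gen //= expn0 mul1r IH.
by case: k => [|k] //; rewrite subn1 /= ltnS subSS.
Qed.

(* The terms j > k are dropped to avoid negative powers of \bar\xi_1; they vanish
   on B_{n-1}(k). *)
Definition reshift (k : nat) (y : Ap) : Ap :=
  \sum_(j < k.+1) xi1 ^+ (k - j) * (wshift 1 y)`_j.

Lemma reshiftB k : zmod_morphism (reshift k).
Proof.
move=> x y; rewrite /reshift -sumrB; apply: eq_bigr => j _.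
by rewrite raddfB coefB mulrBr.
Qed.
HB.instance Definition _ k := GRing.isZmodMorphism.Build Ap Ap (reshift k) (reshiftB k).

Lemma reshift_etaL k m y : reshift k (etaL m * y) = etaL m * reshift k y.
Proof.
rewrite /reshift mulr_sumr; apply: eq_bigr => j _.
by rewrite rmorphM /= wshift_etaL coefCM !mulrA xi1_central.
Qed.

Lemma reshift_monom k w : (monom_wt p w <= k)%N ->
  reshift k (monom w) = xi1 ^+ (k - monom_wt p w) * monom (map (gsh 1) w).
Proof.
move=> wk; have wk' : (monom_wt p w < k.+1)%N by [].
rewrite /reshift (bigD1 (Ordinal wk')) //= big1 => [|j jw].
  by rewrite addr0 wshift_monom coef_mX eqxx.
rewrite wshift_monom coef_mX ifN ?mulr0 //.
Qed.

Lemma reshift_gen k h y :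
  reshift (wt p h + k) (gen h * y) = gen (gsh 1 h) * reshift k y.
Proof.
rewrite /reshift -addnS big_split_ord /= big1 ?add0r => [|j _].
  rewrite mulr_sumr; apply: eq_bigr => j _.
  rewrite wshift_genM subnDl ltnNge leq_addr addKn !mulrA.
  by rewrite xi1_central.
by rewrite wshift_genM ltn_ord mulr0.
Qed.

Lemma BG_rec n k (P : Ap -> Prop) :
  P 0 -> (forall x y, P x -> P y -> P (x + y)) ->
  (forall m x, P x -> P (etaL m * x)) ->
  (forall w, BG_monom p n k w -> P (monom w)) ->
  forall y, @BG_pred p F n k y -> P y.
Proof.
move=> P0 PD PZ Pw y [s [sP ->]]; elim: s sP => [|c s IH] /=.
  by rewrite big_nil.
by case/andP=> cP /IH Ps; rewrite big_cons; apply: PD => //; apply/PZ/Pw.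
Qed.

(** Whatever the weight of a monomial w of y, the factor $\bar\xi_1^{l-\mathrm{wt}(w)}$ brings its
    raised copy to lowered weight exactly $l$; lowering then deletes this factor. *)
Lemma unshift_reshift n k l y : @BG_pred p F n l y ->
  unshift k (reshift l y) = if k == l then y else 0.
Proof.
move: y; apply: BG_rec => [|x y Hx Hy|m x Hx|w /andP[_ wl]].
- by rewrite !raddf0 if_same.
- by rewrite !raddfD /= Hx Hy; case: eqP; rewrite ?addr0.
- by rewrite reshift_etaL unshift_etaL Hx; case: eqP; rewrite ?mulr0.
rewrite reshift_monom // unshift_xi1X unshift_monom.
case: (ltnP k) => kl.
  rewrite ltn_eqF // (leq_trans kl) //; exact: leq_subr.
by congr (if _ then _ else _); lia.
Qed.

Local Notation BG n k := (@BG_pred p F n k).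

Lemma BG_D n k x y : BG n k x -> BG n k y -> BG n k (x + y).
Proof. by move=> Bx By; rewrite -[x]scale1r; apply: BG_predL. Qed.

Lemma BG_Z n k m x : BG n k x -> BG n k (etaL m * x).
Proof.
by move=> Bx; rewrite -[_ * _]addr0; apply: BG_predL => //; apply: BG_pred0.
Qed.

Lemma BG_N n k x : BG n k x -> BG n k (- x).
Proof.
have -> : - x = etaL (-1) * x by rewrite rmorphN rmorph1 mulN1r.
exact: BG_Z.
Qed.

Lemma BG_sum n k I (r : seq I) (P : pred I) (f : I -> Ap) :
  (forall i, P i -> BG n k (f i)) -> BG n k (\sum_(i <- r | P i) f i).
Proof.
by move=> Bf; apply: (big_ind _ (BG_pred0 _ _ _ _)) => // x y; apply: BG_D.
Qed.

Lemma BG_coef n k c x : BG n k x -> BG n k (coef c * x).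
Proof. by rewrite -etaL_gen; apply: BG_Z. Qed.

Lemma wshift_BG e n k y j : BG n k y -> (k < j)%N -> (wshift e y)`_j = 0.
Proof.
move=> By kj; move: y By; apply: BG_rec => [|x y Hx Hy|m x Hx|w /andP[_ wl]].
- by rewrite raddf0 coef0.
- by rewrite raddfD coefD Hx Hy addr0.
- by rewrite rmorphM /= wshift_etaL coefCM Hx mulr0.
- by rewrite wshift_monom coef_mX gtn_eqF // (leq_ltn_trans wl).
Qed.

(** * Weight decomposition of $(A//E(n))^\vee$ *)

Section Truncation.
Variable n : nat.

Lemma BG_dgen k g y : alg_gen n%:Z g -> BG (n%:Z - 1) k y ->
  BG (n%:Z - 1) (dwt g + k) (dgen g * y).
Proof.
case: g => [c|j|i] ng By; first exact: BG_coef.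
  by case: j ng => // j nj; apply: BG_pred_taub => //; move: nj => /=; lia.
by have := BG_pred_xibX i 1 By; rewrite mul1n expr1.
Qed.

Lemma reshift_dgen k g y : alg_gen n%:Z g -> BG (n%:Z - 1) k y ->
  reshift (dwt g + k) (dgen g * y) = gen g * reshift k y.
Proof.
case: g => [c|[|j]|[|i]] // ng By; first exact: (reshift_gen k (Coef c)).
- exact: (reshift_gen k (Tau j)).
(* For $\bar\xi_1$, lowered to 1, the bound grows from k to k+1 with y unchanged: each old term
   gains a factor $\bar\xi_1$, and the new top term vanishes because y has weight at most k. *)
- rewrite /= expn0 mul1r /reshift big_ord_recr /= (wshift_BG 1 By) // mulr0 addr0.
  rewrite mulr_sumr; apply: eq_bigr => j _.
  by rewrite subSn -1?ltnS // exprS mulrA.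
- exact: (reshift_gen k (Xi i)).
Qed.

(** Sums of raised elements contain 1 and, by [reshift_dgen], are stable under the generators, so
    they exhaust $(A//E(n))^\vee$. The induction generalizes [P] so that it can be precomposed with
    negation or with multiplication by a generator. *)
Lemma quotE_reshift_ind (P : Ap -> Prop) :
  P 0 -> (forall x y, P x -> P y -> P (x + y)) ->
  (forall k y, BG (n%:Z - 1) k y -> P (reshift k y)) ->
  forall x, @quotE p F n%:Z x -> P x.
Proof.
move=> P0 PD PT x Ex; move: x Ex P P0 PD PT.
apply: quotE_rec => [||x IH|x y IHx IHy|g x ng IH] P P0 PD PT //.
- have -> : 1 = reshift 0 (monom [::]).
    rewrite reshift_monom /monom_wt ?big_nil //= /Defs.monom big_nil.
    by rewrite subn0 expr0 mulr1.
  by apply/PT/BG_pred_monom; rewrite /BG_monom /monom_wt /= big_nil.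
- apply: (IH (fun x => P (- x))) => [|u v Pu Pv|k y By]; first by rewrite oppr0.
    by rewrite opprD; apply: PD.
  rewrite -raddfN; apply: PT.
  exact: BG_N.
- by apply: (PD x y); [apply: IHx | apply: IHy].
- apply: (IH (fun x => P (gen g * x))) => [|u v Pu Pv|k y By].
    by rewrite mulr0.
    by rewrite mulrDr; apply: PD.
  by rewrite -reshift_dgen //; apply/PT/BG_dgen.
Qed.

Lemma unshift_BG k x : @quotE p F n%:Z x -> BG (n%:Z - 1) k (unshift k x).
Proof.
move: x; apply: quotE_reshift_ind => [|x y Bx By|l y By].
- by rewrite raddf0; apply: BG_pred0.
- by rewrite raddfD; apply: BG_D.
- by rewrite (unshift_reshift k By); case: eqP => [->//|_]; apply: BG_pred0.
Qed.

Lemma reshift_unshift_large x : @quotE p F n%:Z x ->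
  exists N0, forall N, (N0 <= N)%N -> \sum_(k < N) reshift k (unshift k x) = x.
Proof.
move: x; apply: quotE_reshift_ind => [|x y [N Hx] [N' Hy]|l y By].
- by exists 0%N => N _; rewrite big1 // => k _; rewrite !raddf0.
- exists (maxn N N') => M; rewrite geq_max => /andP[NM N'M].
  under eq_bigr do rewrite !raddfD /=.
  by rewrite big_split /= Hx ?Hy.
- exists l.+1 => N lN; rewrite (bigD1 (Ordinal lN)) //= big1 => [|k kl].
    by rewrite addr0 (unshift_reshift _ By) eqxx.
  by rewrite (unshift_reshift _ By) ifN ?raddf0.
Qed.

(** The sum agrees with a longer one covered by [reshift_unshift_large], as the additional
    components vanish. *)
Lemma reshift_unshift x N : @quotE p F n%:Z x -> (forall k, (N <= k)%N -> unshift k x = 0) ->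
  \sum_(k < N) reshift k (unshift k x) = x.
Proof.
move=> Ex xN; have [N0 H] := reshift_unshift_large Ex.
rewrite -[RHS](H (maxn N N0)) ?leq_maxr //.
rewrite (big_ord_widen_cond _ xpredT (fun k => reshift k (unshift k x)) (leq_maxl N N0)).
rewrite [RHS](bigID (fun k : 'I__ => k < N)%N) /= [X in _ + X]big1 ?addr0 // => k.
by rewrite -leqNgt => /xN ->; rewrite raddf0.
Qed.

(** Raising multiplies the weight of a monomial w by $p$, and $\bar\xi_1^{k-\mathrm{wt}(w)}$
    contributes the remaining $p(k-\mathrm{wt}(w))$. *)
Lemma BG_reshift k y : BG (n%:Z - 1) k y -> BG n%:Z (p * k) (reshift k y).
Proof.
move: y; apply: BG_rec => [|x y Hx Hy|m x Hx|w /andP[nw wk]].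
- by rewrite raddf0; apply: BG_pred0.
- by rewrite raddfD; apply: BG_D.
- by rewrite reshift_etaL; apply: BG_Z.
rewrite reshift_monom //.
have sw : monom_wt p (map (gsh 1) w) = (p * monom_wt p w)%N.
  elim: w {wk} nw => [|g w IH]; first by rewrite /monom_wt !big_nil muln0.
  case/andP=> gn /IH wE; rewrite /= !monom_wt_cons wE mulnDr; congr addn.
  by case: g gn => [c|j|i] //= _; rewrite expnS.
have Bw : BG n%:Z (p * monom_wt p w) (monom (map (gsh 1) w)).
  apply: BG_pred_monom; rewrite /BG_monom sw leqnn andbT all_map.
  by apply: sub_all nw => -[c|j|i] //=; lia.
have := BG_pred_xibX 1 (k - monom_wt p w) Bw.
by rewrite expn1 mulnC -mulnDr subnK.
Qed.

Lemma BG_quotE (a : int) k y : BG a k y -> @quotE p F a y.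
Proof.
move: y; apply: BG_rec => [|x y Hx Hy|m x Hx|w /andP[nw _]].
- exact: quotE0.
- exact: quotE_add.
- by apply: quotE_mul => //; apply: quotE_coef.
elim: w nw => [|g w IH] /=; first by rewrite /Defs.monom big_nil => _; apply: quotE1.
case/andP=> ng /IH Ew; rewrite monom_cons; apply: quotE_mul => //.
by case: g ng => // [j|i]; [apply: quotE_tau | move=> _; apply: quotE_xi].
Qed.

(** On the generators of $(A//E(n))^\vee$ the weight is $p$ times the lowered weight. *)
Lemma unshift_weight k l x : BG n%:Z k x -> (k < p * l)%N -> unshift l x = 0.
Proof.
move=> Bx kl; move: x Bx; apply: BG_rec => [|x y Hx Hy|m x Hx|w /andP[nw wk]].
- by rewrite raddf0.
- by rewrite raddfD /= Hx Hy addr0.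
- by rewrite unshift_etaL Hx mulr0.
have {wk kl}: (monom_wt p w < p * l)%N by apply: leq_ltn_trans kl.
elim: w l nw => [|g w IH] l /=.
  rewrite /monom_wt /Defs.monom !big_nil unshift1 => _.
  by case: l => //; rewrite muln0.
case/andP=> ng nw; rewrite monom_cons monom_wt_cons => wl.
rewrite unshift_gen; last by case: (g) ng => [|[]|].
case: ltnP => // gl; rewrite IH ?mulr0 //.
suff wg : wt p g = (p * dwt g)%N by rewrite mulnBr -wg; lia.
by case: (g) ng => [c|[|j]|i] //= _; rewrite expnS.
Qed.
End Truncation.

(* A retraction of A^\vee onto B_{m-1}(K): truncate the weights for m = 0; for
   m > 0 write B_{m-1}(K) as the sum of the raised copies of the B_{m-2}(j),
   p j <= K. *)
Fixpoint retr (m K : nat) (x : Ap) : Ap :=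
  if m is m'.+1 then \sum_(j < (K %/ p).+1) reshift j (retr m' j (unshift j x))
  else \sum_(j < K.+1) (wshift 0 x)`_j.

Lemma retrB m K : zmod_morphism (retr m K).
Proof.
elim: m K => [|m IH] K x y /=; rewrite -sumrB; apply: eq_bigr => j _.
  by rewrite raddfB coefB.
by rewrite raddfB IH raddfB.
Qed.

Lemma retr_etaL m K a x : retr m K (etaL a * x) = etaL a * retr m K x.
Proof.
elim: m K x => [|m IH] K x /=; rewrite mulr_sumr; apply: eq_bigr => j _.
  by rewrite rmorphM /= wshift_etaL coefCM.
by rewrite unshift_etaL IH reshift_etaL.
Qed.

Lemma monom_gsh0 w : map (gsh 0) w = w.
Proof. by elim: w => //= -[c|i|i] w ->. Qed.

Lemma quotE_all x : @quotE p F (-1) x.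
Proof.
elim/presented_ind: x => [[c|i|i]|||x IH|x y IHx IHy|x y IHx IHy].
- by rewrite -[Defs.gen _ _]/(coef c) -etaL_gen; apply: quotE_coef.
- exact: quotE_tau.
- exact: quotE_xi.
- exact: quotE0.
- exact: quotE1.
- have -> : - x = etaL (-1) * x by rewrite rmorphN rmorph1 mulN1r.
  by apply: quotE_mul => //; apply: quotE_coef.
- exact: quotE_add.
- exact: quotE_mul.
Qed.

Lemma BG_Psi0 j x : BG (-1) j (wshift 0 x)`_j.
Proof.
move: x (quotE_all x) j.
apply: quotE_rec => [j|j|x IH j|x y IHx IHy j|g x _ IH j].
- by rewrite raddf0 coef0; apply: BG_pred0.
- rewrite rmorph1 coef1; case: j => [|j]; last exact: BG_pred0.
  have := @BG_pred_monom p F (-1) 0 [::].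
  by rewrite /BG_monom /monom_wt /Defs.monom !big_nil; apply.
- by rewrite raddfN coefN; apply: BG_N.
- by rewrite raddfD coefD; apply: BG_D.
rewrite wshift_genM; case: ltnP => [_|gj]; first exact: BG_pred0.
rewrite -{1}(subnKC gj); have {}IH := IH (j - wt p g)%N.
case: g {gj} IH => [c|i|i] IH; first exact: BG_coef.
  exact: BG_pred_taub.
by have := BG_pred_xibX i.+1 1 IH; rewrite mul1n expr1.
Qed.

Lemma retr_BG m K x : BG (m%:Z - 1) K (retr m K x).
Proof.
elim: m K x => [|m IH] K x /=.
  apply: BG_sum => j _; apply: BG_pred_le (BG_Psi0 j x).
  by rewrite -ltnS.
have -> : m.+1%:Z - 1 = m by lia.
apply: BG_sum => j _; have /BG_reshift := IH j (unshift j x); apply: BG_pred_le.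
rewrite mulnC -leq_divRL ?prime_gt0 // -ltnS; exact: ltn_ord.
Qed.

Lemma retr_id m K x : BG (m%:Z - 1) K x -> retr m K x = x.
Proof.
elim: m K x => [|m IH] K x.
  move: x; apply: BG_rec => [|x y Hx Hy|a x Hx|w /andP[_ wK]].
  - by rewrite (zm0 (@retrB 0 K)).
  - by rewrite (zmD (@retrB 0 K)) Hx Hy.
  - by rewrite retr_etaL Hx.
  have wK' : (monom_wt p w < K.+1)%N by [].
  rewrite /= (bigD1 (Ordinal wK')) //= big1 => [|j jw].
    by rewrite addr0 wshift_monom coef_mX eqxx monom_gsh0.
  by rewrite wshift_monom coef_mX ifN.
have -> : m.+1%:Z - 1 = m by lia.
move=> Bx; have Ex := BG_quotE Bx.
(* By [unshift_weight] the components of x with $pk>K$ vanish, so the copies kept by [retr] recover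
   x. *)
rewrite -[RHS](@reshift_unshift m x (K %/ p).+1 Ex) => [|k kK].
  by rewrite /=; apply: eq_bigr => j _; rewrite IH //; apply: unshift_BG.
apply: (unshift_weight Bx); rewrite mulnC -ltn_divLR ?prime_gt0 //.
Qed.

(** * Bidegrees *)

Local Notation H d x := (@homogA p F d x).
Local Notation deg g := (@Defs.deg p F g).

(** The bidegree of $\bar\xi_1^k$, which is also that of the k-th suspension in the theorem. *)
Definition sft (k : nat) : int * int :=
  ((k * (p - 1))%N%:Z *+ 2, (k * (p - 1))%N%:Z).

Lemma sftD j k : sft (j + k) = sft j + sft k.
Proof. by rewrite /sft mulnDl PoszD mulrnDl. Qed.

Lemma hom0 d : H d 0.
Proof. by exists [::]; rewrite big_nil. Qed.

Lemma homD d x y : H d x -> H d y -> H d (x + y).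
Proof.
by move=> [s [sd ->]] [t [td ->]]; exists (s ++ t); rewrite all_cat sd td big_cat.
Qed.

Lemma hom_sum d I (r : seq I) (P : pred I) (f : I -> Ap) :
  (forall i, P i -> H d (f i)) -> H d (\sum_(i <- r | P i) f i).
Proof. by move=> Hf; apply: (big_ind _ (hom0 d)) => // x y; apply: homD. Qed.

Lemma hom_monom w : H (monom_deg p F w) (monom w).
Proof. by exists [:: w]; rewrite /= eqxx big_seq1. Qed.

Lemma homM d e x y : H d x -> H e y -> H (d + e) (x * y).
Proof.
move=> [s [/allP sd ->]] [t [/allP te ->]]; rewrite mulr_suml.
rewrite big_seq; apply: hom_sum => v /sd/eqP <-; rewrite mulr_sumr.
rewrite big_seq; apply: hom_sum => w /te/eqP <-.
have -> : monom v * monom w = monom (v ++ w) by rewrite /Defs.monom big_cat.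
by have := hom_monom (v ++ w); rewrite /monom_deg big_cat.
Qed.

Lemma hom1 : H 0 1.
Proof. by have := hom_monom [::]; rewrite /monom_deg /Defs.monom !big_nil. Qed.

Lemma hom_gen g : H (deg g) (gen g).
Proof. by have := hom_monom [:: g]; rewrite /monom_deg /Defs.monom !big_seq1. Qed.

Lemma homX d x n : H d x -> H (d *+ n) (x ^+ n).
Proof.
move=> Hx; elim: n => [|n IH]; first by rewrite mulr0n expr0; apply: hom1.
by rewrite mulrS exprS; apply: homM.
Qed.

Lemma hom_ind d (P : Ap -> Prop) :
  P 0 -> (forall x y, P x -> P y -> P (x + y)) ->
  (forall w, monom_deg p F w = d -> P (monom w)) -> forall x, H d x -> P x.
Proof.
move=> P0 PD Pw x [s [sd ->]]; elim: s sd => [|w s IH] /=.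
  by rewrite big_nil.
by case/andP=> /eqP wd /IH Ps; rewrite big_cons; apply: PD => //; apply: Pw.
Qed.

(** Homogeneity of degree d when X is given the bidegree of $\bar\xi_1$. *)
Definition hom_poly d (P : {poly Ap}) := forall k, H (d - sft k) P`_k.

Lemma hom_poly0 d : hom_poly d 0.
Proof. by move=> k; rewrite coef0; apply: hom0. Qed.

Lemma hom_polyD d P Q : hom_poly d P -> hom_poly d Q -> hom_poly d (P + Q).
Proof. by move=> HP HQ k; rewrite coefD; apply: homD. Qed.

Lemma hom_polyM d e P Q :
  hom_poly d P -> hom_poly e Q -> hom_poly (d + e) (P * Q).
Proof.
move=> HP HQ k; rewrite coefM; apply: hom_sum => j _.
rewrite -{1}(subnKC (ltn_ord j : j <= k)%N) sftD opprD addrACA.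
exact: homM.
Qed.

Lemma hom_mX d n a : H (d - sft n) a -> hom_poly d (mX a n).
Proof. by move=> Ha k; rewrite coef_mX; case: eqP => [->|_] //; apply: hom0. Qed.

(* The two basis vectors have degrees differing by (1, 0), which makes Tau0_mx
   homogeneous of the degree of \bar\tau_0 when twist = 1. *)
Definition off (i : 'I_2) : int * int := ((i : nat)%:Z, 0).

Definition hom_mx d (A : 'M[{poly Ap}]_2) :=
  forall i j, hom_poly (d + off j - off i) (A i j).

Lemma hom_mxM d e A B : hom_mx d A -> hom_mx e B -> hom_mx (d + e) (A * B).
Proof.
move=> HA HB i j; rewrite mxE.
apply: (big_ind _ (hom_poly0 _)) => [|k _]; first exact: hom_polyD.
have -> : d + e + off j - off i = (d + off k - off i) + (e + off j - off k).
  by rewrite addrACA -!addrA; congr (_ + _); rewrite addrC; ring.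
exact: hom_polyM.
Qed.

Lemma hom_scalar d P : hom_poly d P -> hom_mx d P%:M.
Proof.
move=> HP i j; rewrite mxE; case: eqP => [->|_]; last exact: hom_poly0.
by rewrite mulr1n addrK.
Qed.

Hypothesis F_char : char_neq F p.

(* Hence \Theta has degree (0, -1) for p = 2, as homogeneity of the relation for
   \bar\tau_i^2 requires. *)
Lemma twist2 : p = 2%N -> twist p F = 1%N.
Proof.
rewrite /twist; case: F F_char => [||K] //= pK p2; first by rewrite p2.
(* The order of K is a power of its characteristic, so an even order would force characteristic 2.
   An odd order is 1 mod 2, and the search in [twist] stops at its first candidate. *)
have qodd : odd #|K|.
  apply: contraR pK => qe; rewrite p2.
  have [q q_pr qc] := finPcharP K.
  have q2 : (2 %| q ^ logn q #|K|)%N by rewrite -(card_pprimeChar qc) dvdn2.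
  have : (2 %| q)%N by move: q2; rewrite Euclid_dvdX // => /andP[].
  by rewrite dvdn_prime2 // => /eqP ->.
by rewrite p2 /= expn1 modn2 qodd.
Qed.

Lemma sftE k : sft k = (k%:Z * (p%:Z - 1) *+ 2, k%:Z * (p%:Z - 1)).
Proof. by rewrite /sft PoszM -subzn ?prime_gt0. Qed.

(** Since $2p^{i+1}-2p^i=2p^i(p-1)$, raising an index costs one bidegree of $\bar\xi_1$ per unit of
    weight. *)
Lemma deg_gsh g : deg (gsh 1 g) = deg g + sft (wt p g).
Proof.
rewrite sftE; case: g => [[]|i|i] /=; rewrite ?mul0r ?addr0 // !expnS !PoszM;
  by congr (_, _); rewrite /=; ring.
Qed.

Lemma deg_xi1 : deg (Xi 0) = sft 1.
Proof. by rewrite sftE /= expn1; congr (_, _); ring. Qed.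

Lemma hom_Tau0 : hom_mx (deg (Tau 0)) (unshift_gen_mx (Tau 0)).
Proof.
rewrite /unshift_gen_mx eqxx /Tau0_mx; case: eqP => p2; last first.
  by move=> i j; rewrite mxE; apply: hom_poly0.
have tw := twist2 p2.
move=> i j; rewrite mxE.
case: i => [[|[|i]] hi] //; case: j => [[|[|j]] hj] //; rewrite ?[if _ then _ else _]/=.
- exact: hom_poly0.
(* At $p=2$ this is $(1,0)+(1,0)-(2,1)=(0,-1)$, the bidegree of $\Theta$ and of the Bockstein class
   times $\bar\tau_0$. *)
- have d01 : deg (Tau 0) + off (Ordinal hj) - off (Ordinal hi) - sft 1 = (0, - 1).
    by rewrite /sft p2.
  apply: hom_mX; rewrite d01; apply: homD.
    by have := hom_gen (Coef Theta); rewrite /= tw.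
  rewrite /Defs.bockA; case: has_bock; last by rewrite mul0r; apply: hom0.
  have := homM (hom_gen (Coef Gam)) (hom_gen (Tau 0)).
  by rewrite /= tw expn0.
- have d10 : deg (Tau 0) + off (Ordinal hj) - off (Ordinal hi) - sft 0 = 0.
    by rewrite /sft /= expn0.
  have -> : true%:R = mX 1 0 by rewrite /mX mulr1.
  by apply: hom_mX; rewrite d10; apply: hom1.
- exact: hom_poly0.
Qed.

Lemma hom_unshift_gen_mx g : hom_mx (deg g) (unshift_gen_mx g).
Proof.
case gT: (isTau0 g); first by case: g gT => [|[]|] // _; apply: hom_Tau0.
rewrite unshift_genE ?gT //; apply/hom_scalar/hom_mX.
have sh h : H (deg (gsh 1 h) - sft (dwt (gsh 1 h))) (dgen (gsh 1 h)).
  by rewrite deg_gsh dwt_gsh dgen_gsh addrK; apply: hom_gen.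
case: g gT => [c|[|j]|[|i]] // _; [exact: (sh (Coef c))|exact: (sh (Tau j))| |exact: (sh (Xi i))].
by rewrite deg_xi1 /dwt expn0 subrr; apply: hom1.
Qed.

(** Proved for the whole matrix, which is multiplicative, and then read off at entry (0,0).
    Monomials containing $\bar\tau_0$ must be included: homogeneity in $(A//E(n))^\vee$ is that of
    $A^\vee$. *)
Lemma hom_unshift d k x : H d x -> H (d - sft k) (unshift k x).
Proof.
move=> Hx; suff /(_ 0 0 k) : hom_mx d (unshift_mx x) by rewrite addrK.
move: x Hx; apply: hom_ind => [|x y Hx Hy|w <-].
- by rewrite raddf0 => i j; rewrite mxE; apply: hom_poly0.
- rewrite raddfD => i j; rewrite mxE.
  by apply: hom_polyD; [apply: Hx|apply: Hy].
elim: w => [|g w IH].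
  rewrite /monom_deg /Defs.monom !big_nil rmorph1; apply: hom_scalar.
  have -> : 1 = mX 1 0 by rewrite /mX mulr1.
  by apply: hom_mX; rewrite /sft subrr; apply: hom1.
rewrite monom_cons /monom_deg big_cons rmorphM /=; apply: hom_mxM => //.
by rewrite unshift_mx_gen; apply: hom_unshift_gen_mx.
Qed.

(** Raising the part of weight $j$ adds [sft j], and $\bar\xi_1^{k-j}$ adds the rest. *)
Lemma hom_reshift d k y : H d y -> H (d + sft k) (reshift k y).
Proof.
move=> Hy; apply: hom_sum => j _; have jk : (j <= k)%N by rewrite -ltnS.
have -> : d + sft k = sft (k - j) + (d + sft j) by rewrite addrCA -sftD subnK.
apply: homM.
  have -> : sft (k - j) = deg (Xi 0) *+ (k - j).
    by elim: (k - j)%N => [|m IH]; rewrite ?mulr0n // -add1n sftD mulrS IH deg_xi1.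
  exact/homX/hom_gen.
move: y Hy; apply: hom_ind => [|x y Hx Hy|w <-].
- by rewrite raddf0 coef0; apply: hom0.
- by rewrite raddfD coefD; apply: homD.
rewrite wshift_monom coef_mX; case: eqP => [->|_]; last exact: hom0.
have -> : monom_deg p F w + sft (monom_wt p w) = monom_deg p F (map (gsh 1) w).
  elim: {j jk} w => [|g w IH]; first by rewrite /monom_deg /monom_wt !big_nil.
  rewrite monom_wt_cons sftD /monom_deg /= !big_cons addrACA -deg_gsh.
  by congr (_ + _).
exact: hom_monom.
Qed.

(** * The coaction *)

Section Coaction.
Variable n : nat.

Local Notation etaRm := (@etaR p F : {rmorphism Mp -> Ap}).
Local Notation RE := (etaRE p F n%:Z).
Local Notation E := (Ep p F n%:Z).
Local Notation prE := (@projE p F n%:Z).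
Local Notation EA := (tensor RE Ap).
Local Notation coactE := (@coactE p F n%:Z).

Local Notation genE g := (Defs.gen (Erel p F n%:Z) g : E).

Lemma projE_gen g : prE (gen g) = genE g.
Proof. exact: (rlift_gen (@projE_sat p F n%:Z)). Qed.

Lemma genE_xi i : genE (Xi i) = 0.
Proof. exact: (presented_rel (gc_extra _ _ (Eextra_xi _ _ _ i))). Qed.

Lemma genE_tau (j : nat) : (n < j)%N -> genE (Tau j) = 0.
Proof.
move=> nj; have nj' : n%:Z < j%:Z by [].
exact: (presented_rel (gc_extra _ _ (Eextra_tau _ _ nj'))).
Qed.

Local Notation Einv_gen := (gcinv_gen Aodd p (Eextra p F n%:Z)).

Lemma projE_inv_gen g : prE (gcinv_gen Aodd p (Aextra p F) g) = Einv_gen g.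
Proof. by rewrite /gcinv_gen rmorphM rmorph_sign /= projE_gen. Qed.

Lemma Eextra_inv s t : Eextra p F n%:Z s t ->
  reval Einv_gen s = reval Einv_gen t.
Proof.
case=> {s t} [s t /Aextra_inv/(congr1 prE)|i|j nj].
- rewrite !reval_rmorph.
  have /funext -> : prE \o gcinv_gen Aodd p (Aextra p F) =1 Einv_gen.
    exact: projE_inv_gen.
  by [].
- by rewrite /= /gcinv_gen genE_xi mulr0.
- by rewrite /= /gcinv_gen genE_tau // mulr0.
Qed.

(** The involution $e\mapsto(-1)^{|e|}e$ of $E(n)^\vee$: the Koszul sign for moving
    $1\otimes\bar\tau_k$ past $e\otimes 1$. *)
Definition Einv : E -> E := gcinv (extra := Eextra p F n%:Z).
HB.instance Definition _ := GRing.isZmodMorphism.Build E E Einv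
  (rlift_zmod (gcinv_sat Eextra_inv)).
HB.instance Definition _ := GRing.isMonoidMorphism.Build E E Einv
  (rlift_monoid (gcinv_sat Eextra_inv)).

Lemma Einv_projE x : Einv (prE x) = prE (@Ainv p F x).
Proof.
elim/presented_ind: x => [g|||x IH|x y IHx IHy|x y IHx IHy].
- rewrite projE_gen Ainv_gen rmorphM rmorph_sign /= projE_gen.
  exact: (gcinv_genE Eextra_inv).
- by rewrite !rmorph0.
- by rewrite !rmorph1.
- by rewrite !rmorphN /= IH.
- by rewrite !rmorphD /= IHx IHy.
- by rewrite !rmorphM /= IHx IHy.
Qed.

Definition lmulE (x : E) (y : Ap) : EA -> EA :=
  tmap RE RE (fun e => x * e) (fun z => y * z).
Definition tauE (k : nat) : EA -> EA :=
  tmap RE RE Einv (fun z => taub k * z).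

Lemma lmulE_bimap x y : central y ->
  bimap RE RE (fun e : E => x * e) (fun z : Ap => y * z).
Proof.
move=> Cy; split=> [e e'|z z'|e m z]; rewrite ?mulrDr //.
by rewrite [x * _]mulrA tens_bal !ApZ !mulrA Cy.
Qed.

Lemma tauE_bimap k : bimap RE RE Einv (fun z : Ap => taub k * z).
Proof.
split=> [e e'|z z'|e m z]; rewrite ?mulrDr ?rmorphD //.
rewrite rmorphM /= Einv_projE Ainv_etaR tens_bal !ApZ [in RHS]mulrA.
by rewrite [taub k * etaL m]taub_swap Ainv_etaL mulrA.
Qed.

(* Left multiplication by the image of \psi(g) in E(n)^\vee \otimes A^\vee; for
   g = Tau l the terms with i > n vanish, so that for l >= n its range can
   be taken independent of l. *)
Definition Eop (g : Agen) (t : EA) : EA :=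
  match g with
  | Coef c => lmulE (prE (coef c)) 1 t
  | Xi i => lmulE 1 (xib i.+1) t
  | Tau l => tauE l t +
      \sum_(i < n.+1) lmulE (prE (taub i)) (xib (l - i) ^+ (p ^ i)) t
  end.

Lemma EopB g : zmod_morphism (Eop g).
Proof.
case: g => [c|l|i] /=.
- exact: (tmap_zmod (lmulE_bimap _ (@central1 p F))).
- apply: (addB (tmap_zmod (tauE_bimap l))); apply: sumB => i.
  exact: (tmap_zmod (lmulE_bimap _ (central_xibX _ _))).
- exact: (tmap_zmod (lmulE_bimap _ (central_xib _))).
Qed.

Lemma Eop_tens g e x : Eop g (tens RE e x) =
  match g with
  | Coef c => tens RE (prE (coef c) * e) x
  | Xi i => tens RE e (xib i.+1 * x)
  | Tau l => tens RE (Einv e) (taub l * x) +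
      \sum_(i < n.+1) tens RE (prE (taub i) * e) (xib (l - i) ^+ (p ^ i) * x)
  end.
Proof.
case: g => [c|l|i].
- by rewrite [LHS](tmap_tens (lmulE_bimap _ (@central1 p F))) mul1r.
- rewrite /Eop [tauE _ _](tmap_tens (tauE_bimap l)); congr (_ + _).
  apply: eq_bigr => i _.
  exact: (tmap_tens (lmulE_bimap _ (central_xibX _ _))).
- by rewrite [LHS](tmap_tens (lmulE_bimap _ (central_xib _))) mul1r.
Qed.

Lemma projE_bimap : bimap etaRm RE prE (id : Ap -> Ap).
Proof. by split=> // [e e'|e m s]; rewrite ?rmorphD // rmorphM -tens_bal. Qed.

(** In $E(n)^\vee$ the $\bar\xi_i$ with $i\ge1$ and the $\bar\tau_i$ with $i>n$ vanish, which
    truncates the coproduct to [Eop]. The index $\bar\tau_n$ is allowed because it arises by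
    lowering $\bar\tau_{n+1}$. *)
Lemma coactE_gen g x : alg_gen (n%:Z - 1) g ->
  coactE (gen g * x) = Eop g (coactE x).
Proof.
move=> ng; rewrite /Defs.coactE coprodM; move: (coprod _) => t.
have PB := tmap_zmod projE_bimap; have Pt := tmap_tens projE_bimap.
apply: (tensor_ext (compB PB (@coprod_opB p F g)) (compB (EopB g) PB)) t => e y.
rewrite Pt Eop_tens; case: g ng => [c|l|k] ng /=.
- rewrite lmul_tens; last exact: central1.
  by rewrite Pt rmorphM mul1r.
- rewrite (zmD PB) lmul_tau_tens Pt Einv_projE; congr (_ + _).
  rewrite (zm_sum PB).
  pose f i := tens RE (prE (taub i) * prE e) (xib (l - i) ^+ (p ^ i) * y).
  have nl : (n <= l)%N by move: ng => /=; lia.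
  transitivity (\sum_(i < l.+1) f i).
    apply: eq_bigr => i _; rewrite lmul_tens; last exact: central_xibX.
    by rewrite Pt rmorphM.
  rewrite [RHS](big_ord_widen l.+1 f) // [LHS](bigID (fun i : 'I__ => i < n.+1)%N) /=.
  rewrite [X in _ + X]big1 ?addr0 // => i; rewrite -leqNgt => ni.
  by rewrite /f /Defs.taub projE_gen genE_tau // mul0r tens0l.
- rewrite (zm_sum PB) big_ord_recl big1 ?addr0 => [|i _].
    rewrite lmul_tens; last exact: central_xibX.
    by rewrite Pt mul1r subn0 expn0 expr1.
  rewrite lmul_tens; last exact: central_xibX.
  by rewrite Pt rmorphM /= projE_gen genE_xi mul0r tens0l.
Qed.

Lemma unshift_bimap k : bimap RE RE id (unshift k).
Proof.
split=> // [x y|e m x]; first exact: raddfD.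
by rewrite tens_bal !ApZ unshift_etaL.
Qed.

Local Notation unshiftE k := (tmap RE RE id (unshift k)).

Lemma unshift_xibX i j x l : unshift l (xib i.+1 ^+ (p ^ j) * x) =
  if (l < p ^ (i + j))%N then 0 else xib i ^+ (p ^ j) * unshift (l - p ^ (i + j)) x.
Proof.
rewrite expnD; elim: (p ^ j)%N l => [|m IH] l.
  by rewrite muln0 !expr0 !mul1r subn0.
rewrite exprS -mulrA unshift_gen //= IH mulnS; case: ltnP => li.
  by rewrite ltn_addr.
rewrite -(subnKC li) ltn_add2l subnDl addKn; case: ltnP => _; first by rewrite mulr0.
by rewrite exprS mulrA.
Qed.

(** In the coproduct of $\bar\tau_{l+1}$, lowering replaces $\bar\xi_{l+1-i}^{p^i}$ by
    $\bar\xi_{l-i}^{p^i}$, of weight $p^{l-i}p^i=p^l$ for every $i\le n\le l$. All terms thus shift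
    k by the same amount. *)
Lemma unshiftE_Eop k h t : alg_gen (n%:Z - 1) h -> unshiftE k (Eop (gsh 1 h) t) =
  if (k < wt p h)%N then 0 else Eop h (unshiftE (k - wt p h) t).
Proof.
move=> nh; have SB l := tmap_zmod (unshift_bimap l).
have St l := tmap_tens (unshift_bimap l).
have zB : zmod_morphism (fun _ : EA => 0 : EA) by move=> ? ?; rewrite subr0.
have rB : zmod_morphism (fun t =>
    if (k < wt p h)%N then 0 else Eop h (unshiftE (k - wt p h) t)).
  by case: (k < _)%N => //; apply: (compB (EopB h) (SB _)).
apply: (tensor_ext (compB (SB k) (EopB (gsh 1 h))) rB) t => e x.
rewrite St Eop_tens Eop_tens; case: h nh {rB} => [c|l|i] nh /=.
- by rewrite St subn0.
- have nl : (n <= l)%N by move: nh => /=; lia.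
  rewrite (zmD (SB k)) St unshift_gen //= (zm_sum (SB k)).
  have SX (i : 'I_n.+1) y : unshift k (xib (l.+1 - i) ^+ (p ^ i) * y) =
      if (k < p ^ l)%N then 0 else xib (l - i) ^+ (p ^ i) * unshift (k - p ^ l) y.
    have il : (i <= l)%N by rewrite (leq_trans _ nl) // -ltnS.
    by rewrite subSn // unshift_xibX subnK.
  have -> : \sum_(i < n.+1)
      unshiftE k (tens RE (prE (taub i) * e) (xib (l.+1 - i) ^+ (p ^ i) * x)) =
    \sum_(i < n.+1) tens RE (prE (taub i) * e)
      (if (k < p ^ l)%N then 0 else xib (l - i) ^+ (p ^ i) * unshift (k - p ^ l) x).
    by apply: eq_bigr => i _; rewrite St SX.
  case: ltnP => // _; rewrite tens0r add0r big1 // => i _; exact: tens0r.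
- rewrite St unshift_gen //; case: ltnP => // _; exact: tens0r.
Qed.

Lemma unshiftE_Eop_xi1 k t :
  unshiftE k (Eop (Xi 0) t) = if k is k'.+1 then unshiftE k' t else 0.
Proof.
have SB l := tmap_zmod (unshift_bimap l).
have St l := tmap_tens (unshift_bimap l).
have zB : zmod_morphism (fun _ : EA => 0 : EA) by move=> ? ?; rewrite subr0.
have rB : zmod_morphism (fun t => if k is k'.+1 then unshiftE k' t else 0).
  by case: k.
apply: (tensor_ext (compB (SB k) (EopB (Xi 0))) rB) t => e x.
rewrite Eop_tens St unshift_gen //=; case: k {rB} => [|k]; first exact: tens0r.
by rewrite St expn0 mul1r subn1.
Qed.

Lemma coactEB : zmod_morphism coactE.
Proof. exact: (compB (tmap_zmod projE_bimap) (@coprod_zmod p F)). Qed.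

(** One generator at a time: each is some [gsh 1 h], covered by [unshiftE_Eop], except $\bar\xi_1$,
    which coacts as $1\otimes\bar\xi_1$ and lowers to 1. *)
Lemma coactE_unshift k x : @quotE p F n%:Z x -> unshiftE k (coactE x) = coactE (unshift k x).
Proof.
have SB l := tmap_zmod (unshift_bimap l).
have c1 : coactE 1 = tens RE 1 (1 : Ap).
  by rewrite /Defs.coactE coprod1 (tmap_tens projE_bimap) rmorph1.
move=> Ex; move: x Ex k; apply: quotE_rec => [k|k|x IH k|x y IHx IHy k|g x ng IH k].
- by rewrite raddf0 (zm0 coactEB) (zm0 (SB k)).
- rewrite c1 (tmap_tens (unshift_bimap k)) unshift1.
  by case: eqP; rewrite ?c1 // (zm0 coactEB) tens0r.
- by rewrite raddfN !(zmN coactEB) (zmN (SB k)) IH.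
- by rewrite raddfD !(zmD coactEB) (zmD (SB k)) IHx IHy.
have ng' : alg_gen (n%:Z - 1) g by case: g ng => //= j; lia.
rewrite coactE_gen //.
have sh h : alg_gen (n%:Z - 1) h -> unshiftE k (Eop (gsh 1 h) (coactE x)) =
    coactE (unshift k (gen (gsh 1 h) * x)).
  move=> nh; rewrite unshiftE_Eop // unshift_gsh IH; case: ltnP => _.
    by rewrite (zm0 coactEB).
  by rewrite coactE_gen.
case: g ng {ng'} => [c|[|j]|[|i]] ng.
- exact: (sh (Coef c)).
- by [].
- by apply: (sh (Tau j)); move: ng => /=; lia.
- rewrite unshiftE_Eop_xi1 unshift_gen //= expn0; case: k {sh} => [|k].
    by rewrite (zm0 coactEB).
  by rewrite mul1r subn1 IH.
- exact: (sh (Xi i)).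
Qed.

(** * The isomorphism *)

Local Notation SubQ := (AquotE p F n%:Z).
Local Notation SubB k := (BG_sub p F (n%:Z - 1) k).
Local Notation C := (H_BPGL p F n%:Z).
Local Notation B k := (even_shift (k * (p - 1))%N%:Z (k * (p - 1))%N%:Z
  (BrownGitler p F n%:Z (n%:Z - 1) k)).
Local Notation D := (dsum_comodule (fun k : nat => B k)).

Lemma sub_val_bimap (S : submodule Ap) : bimap RE RE id (@sub_val _ _ S).
Proof. exact: bimap_id. Qed.

(** The linear retraction [retr] induces a left inverse after tensoring. This makes the coaction on
    $B_{n-1}(K)$ computable inside $E(n)^\vee\otimes A^\vee$. *)
Lemma tmap_sub_val_inj K (t u : tensor RE (sub_car (SubB K))) :
  tmap RE RE id (@sub_val _ _ (SubB K)) t =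
  tmap RE RE id (@sub_val _ _ (SubB K)) u -> t = u.
Proof.
pose r (x : Ap) : sub_car (SubB K) := @sub_in _ _ (SubB K) _ (retr_BG n K x).
have rB : bimap RE RE id r.
  apply: bimap_id => [x y|a x]; apply: sub_val_inj.
    exact: (zmD (@retrB n K)).
  exact: retr_etaL.
have rK : cancel (@sub_val _ _ (SubB K)) r.
  by move=> x; apply/sub_val_inj/retr_id/(@sub_car_pred _ _ (SubB K)).
have idB : zmod_morphism (id : tensor RE (sub_car (SubB K)) -> _) by [].
have B1 := sub_val_bimap (SubB K).
have id_ext v : tmap RE RE id r (tmap RE RE id (@sub_val _ _ (SubB K)) v) = v.
  move: v; apply: (tensor_ext (compB (tmap_zmod rB) (tmap_zmod B1)) idB) => e x.
  by rewrite (tmap_tens B1) (tmap_tens rB) rK.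
by move=> tu; rewrite -(id_ext t) tu id_ext.
Qed.

Definition iso_comp (k : nat) (x : C) : B k :=
  @sub_in _ _ (SubB k) _ (unshift_BG k (sub_car_pred x)).

Lemma sub_val_iso k x : sub_val (iso_comp k x) = unshift k (sub_val x).
Proof. by []. Qed.

Lemma iso_compD k x y : iso_comp k (x + y) = iso_comp k x + iso_comp k y.
Proof. by apply: sub_val_inj; rewrite sub_valD !sub_val_iso sub_valD raddfD. Qed.

Lemma iso_compZ k a x : iso_comp k (a *: x) = a *: iso_comp k x.
Proof. by apply: sub_val_inj; rewrite sub_valZ !sub_val_iso sub_valZ; exact: unshift_etaL. Qed.

Lemma iso_fin x : fin_supp (iso_comp^~ x).
Proof.
have [N xN] := unshift_large (sub_val x); exists N => k Nk.
by apply: sub_val_inj; rewrite sub_val_iso xN.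
Qed.

Definition iso_fun (x : C) : D := @Dsum _ (fun k => B k) _ (iso_fin x).

Lemma iso_fun_linear : linear iso_fun.
Proof.
move=> a x y; apply: dsumP => k.
by rewrite [LHS]iso_compD iso_compZ.
Qed.
HB.instance Definition _ := GRing.isLinear.Build _ _ _ _ iso_fun iso_fun_linear.

Lemma iso_inj : injective iso_fun.
Proof.
move=> x y xy; have xyk k : unshift k (sub_val x) = unshift k (sub_val y).
  by rewrite -!sub_val_iso -[iso_comp k x]/(iso_fun x k) xy.
have [N xN] := unshift_large (sub_val x); apply: sub_val_inj.
rewrite -(reshift_unshift (sub_car_pred x) xN) -(reshift_unshift (sub_car_pred y) (N := N)).
  by apply: eq_bigr => k _; rewrite xyk.
by move=> k Nk; rewrite -xyk xN.
Qed.

Lemma iso_surj (y : D) : exists x, iso_fun x = y.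
Proof.
have [N yN] := dsum_fin y.
have By k : BG (n%:Z - 1) k (sub_val (y k)) := @sub_car_pred _ _ (SubB k) (y k).
pose x := \sum_(k < N) reshift k (sub_val (y k)).
have Ex : @quotE p F n%:Z x.
  apply: (big_ind _ (quotE0 _ _ _)) => [u v|k _]; first exact: quotE_add.
  exact: BG_quotE (BG_reshift (By k)).
suff Shx j : unshift j x = sub_val (y j).
  exists (@sub_in _ _ SubQ _ Ex); apply: dsumP => j; apply: sub_val_inj.
  exact: Shx.
rewrite /x raddf_sum.
transitivity (\sum_(k < N) (if j == k then sub_val (y k) else 0) : Ap).
  by apply: eq_bigr => k _; exact: (unshift_reshift j (By k)).
have [Nj|jN] := leqP N j.
  rewrite yN // big1 // => k _; rewrite gtn_eqF //; exact: leq_trans Nj.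
rewrite (bigD1 (Ordinal jN)) //= eqxx big1 ?addr0 // => k.
by rewrite -val_eqE eq_sym => /negbTE /= ->.
Qed.

Lemma iso_homog d x : cm_homog d x <-> cm_homog d (iso_fun x).
Proof.
split=> [Hx k|Hx]; first exact: hom_unshift.
have [N xN] := unshift_large (sub_val x).
rewrite /= -(reshift_unshift (sub_car_pred x) xN); apply: hom_sum => k _.
by rewrite -(subrK (sft k) d); apply/hom_reshift/(Hx k).
Qed.

Lemma coact_C x :
  tmap RE RE id (@sub_val _ _ SubQ) (@cm_coact _ _ _ C x) = coactE (sub_val x).
Proof. exact: (svalP (cid (@AquotE_coact p F n%:Z n%:Z x))). Qed.

Lemma coact_B k x :
  tmap RE RE id (@sub_val _ _ (SubB k)) (@cm_coact _ _ _ (B k) x) =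
  coactE (sub_val x).
Proof. exact: (svalP (cid (@BG_coact p F n%:Z (n%:Z - 1) k x))). Qed.

Lemma iso_comp_bimap k : bimap RE RE id (iso_comp k).
Proof. by apply: bimap_id; [apply: iso_compD | apply: iso_compZ]. Qed.

(** Both sides become [coactE (unshift k (sub_val x))] in $E(n)^\vee\otimes A^\vee$, where
    [tmap_sub_val_inj] allows them to be compared. *)
Lemma iso_comp_coact k x :
  tmap RE RE id (iso_comp k) (@cm_coact _ _ _ C x) =
  @cm_coact _ _ _ (B k) (iso_comp k x).
Proof.
apply: tmap_sub_val_inj; rewrite coact_B sub_val_iso.
have -> : coactE (unshift k (sub_val x)) = unshiftE k (tmap RE RE id (@sub_val _ _ SubQ)
    (@cm_coact _ _ _ C x)).
  by rewrite coact_C -coactE_unshift //; exact: (@sub_car_pred _ _ SubQ x).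
have B1 := iso_comp_bimap k; have B2 := sub_val_bimap (SubB k).
have B3 := sub_val_bimap SubQ; have B4 := unshift_bimap k.
have B5 : bimap RE RE id (unshift k \o @sub_val _ _ SubQ).
  by apply: bimap_id => [u v|a u]; rewrite /= ?raddfD //; exact: unshift_etaL.
rewrite (tmap_comp B3 B4 B5) (tmap_comp B1 B2) //.
Qed.

Lemma coact_B0 k : @cm_coact _ _ _ (B k) 0 = 0.
Proof.
apply: tmap_sub_val_inj; rewrite coact_B (tmap0 (sub_val_bimap _)).
exact: (zm0 coactEB).
Qed.

Lemma dsum_inj_bimap k : bimap RE RE id (@dsum_inj _ (fun k => B k) k).
Proof. by apply: bimap_id => [x y|a x]; [apply: dsum_injD|apply: dsum_injZ]. Qed.

Lemma iso_bimap : bimap RE RE id iso_fun.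
Proof. by apply: bimap_id => [x y|a x]; rewrite ?linearD ?linearZ. Qed.

(** The support bound of [iso_fun x] depends on x; a tensor involves finitely many x, so induction
    on t yields a common bound. *)
Lemma tmap_iso t : exists N0, forall N, (N0 <= N)%N ->
  tmap RE RE id iso_fun t =
  \sum_(k < N) tmap RE RE id (@dsum_inj _ (fun k => B k) k)
                 (tmap RE RE id (iso_comp k) t).
Proof.
have fB := tmap_zmod iso_bimap; have jB k := tmap_zmod (dsum_inj_bimap k).
have cB k := tmap_zmod (iso_comp_bimap k).
elim/tensor_ind: t => [e x||t [N Ht]|t u [N Ht] [N' Hu]].
- have [N0 xN0] := iso_fin x; exists N0 => N N0N.
  rewrite (tmap_tens iso_bimap) (@dsum_decomp _ _ (iso_fun x) N); last first.
    by move=> k Nk; apply/xN0/(leq_trans N0N).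
  rewrite tens_sumr; apply: eq_bigr => k _.
  by rewrite (tmap_tens (iso_comp_bimap k)) (tmap_tens (dsum_inj_bimap k)).
- exists 0%N => N _; rewrite (zm0 fB) big1 // => k _.
  by rewrite (zm0 (cB k)) (zm0 (jB k)).
- exists N => M NM; rewrite (zmN fB) (Ht M NM) -sumrN; apply: eq_bigr => k _.
  by rewrite (zmN (cB k)) (zmN (jB k)).
- exists (maxn N N') => M; rewrite geq_max => /andP[NM N'M].
  rewrite (zmD fB) (Ht M NM) (Hu M N'M) -big_split; apply: eq_bigr => k _.
  by rewrite (zmD (cB k)) (zmD (jB k)).
Qed.

Lemma iso_coact x :
  @cm_coact _ _ _ D (iso_fun x) = tmap RE RE id iso_fun (@cm_coact _ _ _ C x).
Proof.
have [N1 H1] := tmap_iso (@cm_coact _ _ _ C x).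
rewrite [LHS]/(dsum_coact _) /dsum_coact; case: cid => N0 /= fN0.
(* [dsum_coact] stops at a chosen support bound [N0]. Both sums are extended to [maxn N0 N1]; the
   terms added beyond [N0] are coactions of 0. *)
rewrite (H1 _ (leq_maxr N0 N1)).
under [RHS]eq_bigr do rewrite iso_comp_coact.
pose c k := tmap RE RE id (@dsum_inj _ (fun k => B k) k)
              (@cm_coact _ _ _ (B k) (iso_comp k x)).
rewrite -[RHS]/(\sum_(k < maxn N0 N1) c k) -[LHS]/(\sum_(k < N0) c k).
rewrite (big_ord_widen _ c (leq_maxl N0 N1)).
rewrite big_mkcond /=; apply: eq_bigr => k _; case: ltnP => // N0k.
have {N0k} fk : iso_comp k x = 0 by exact: fN0.
rewrite /c fk.
by rewrite coact_B0 (tmap0 (dsum_inj_bimap k)).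
Qed.

Lemma BPGL_comodule_iso : comodule_iso C D.
Proof.
exists iso_fun; split; last exact: iso_coact; last exact: iso_homog.
exists (fun y => sval (cid (iso_surj y))) => [x|y].
  by apply: iso_inj; exact: (svalP (cid (iso_surj (iso_fun x)))).
exact: (svalP (cid (iso_surj y))).
Qed.
End Coaction.
End Main.

Theorem theorem1p5 (p : nat) (F : base) (p_prime : prime p)
    (F_char : char_neq F p) (n : nat) :
  comodule_iso
    (H_BPGL p F n%:Z)
    (dsum_comodule (fun k : nat =>
       even_shift (k * (p - 1))%N%:Z (k * (p - 1))%N%:Z
         (BrownGitler p F n%:Z (n%:Z - 1) k))).
Proof. exact: BPGL_comodule_iso. Qed.
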